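(* There exists a separable Banach space $\mathbb{G}$, unique up to linear isometry, such that Odd has a strategy $\Sigma$ in the game $\operatorname{BM}(\mathcal{B})$ leading to $\mathbb{G}$; that is, whenever Odd uses the strategy $\Sigma$, then no matter how Eve plays, the completion of the union $\bigcup_{n\in\mathbb{N}}E_n$ of the chain $E_0\subseteq E_1\subseteq E_2\subseteq\cdots$ resulting from the play is linearly isometric to $\mathbb{G}$. Furthermore, $\mathbb{G}$ is (linearly isometric to) the Gurarii space.
   Context: All normed spaces are over a fixed scalar field ($\mathbb{R}$ or $\mathbb{C}$), and all mappings between them are linear. $\mathbb{N}=\{0,1,2,\dots\}$. A chain of normed spaces is a sequence $\{E_n\}_{n\in\mathbb{N}}$ of normed spaces such that, for every $n$, $E_n\subseteq E_{n+1}$ is a linear subspace and the norm of $E_{n+1}$ restricted to $E_n$ coincides with the norm of $E_n$. The game $\operatorname{BM}(\mathcal{B})$: two players, Eve and Odd, alternately choose finite-dimensional Banach spaces forming a chain $E_0\subseteq E_1\subseteq E_2\subseteq\cdots$, with no additional rules. Eve starts and chooses $E_n$ for even $n$; Odd chooses $E_n$ for odd $n$. The result of the play is the completion of $\bigcup_{n\in\mathbb{N}}E_n$ (with the common norm). A strategy of Odd is a rule assigning to every finite chain $E_0\subseteq E_1\subseteq\cdots\subseteq E_{2k}$ of finite-dimensional normed spaces (the moves made so far, the last one by Eve) a finite-dimensional normed space $E_{2k+1}\supseteq E_{2k}$ whose norm extends that of $E_{2k}$. Odd uses the strategy in a play if each of Odd's moves is the one prescribed by it. A strategy of Odd leads to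 a Banach space $G$ if the completion of the union of every chain resulting from a play in which Odd uses this strategy is linearly isometric to $G$. An isometric embedding is a linear map $e$ with $\|e(x)\|=\|x\|$ for all $x$. For $\varepsilon>0$, an $\varepsilon$-isometric embedding is a linear map $f\colon X\to Y$ with $(1-\varepsilon)\|x\|\leq\|f(x)\|\leq(1+\varepsilon)\|x\|$ for every $x\in X$. The Gurarii space is the unique (up to linear isometry) separable Banach space $\mathbb{G}$ satisfying: for every $\varepsilon>0$, for all finite-dimensional normed spaces $A\subseteq B$ (with the norm of $B$ extending that of $A$), every isometric embedding $e\colon A\to\mathbb{G}$ has an extension $f\colon B\to\mathbb{G}$ that is an $\varepsilon$-isometric embedding. *)

(* Defs.v *)
(* Libraries: MathComp, MathComp-Analysis, and real-closed for R[i]. *)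
From HB Require Import structures.
From mathcomp Require Import all_boot all_order all_algebra.
From mathcomp Require Import complex.
From mathcomp Require Import all_classical all_reals topology normedtype.

Set Implicit Arguments.
Unset Strict Implicit.
Unset Printing Implicit Defensive.

Import Order.TTheory GRing.Theory Num.Theory.
Import numFieldNormedType.Exports.

Local Open Scope classical_set_scope.
Local Open Scope ring_scope.

Variant real_or_complex (R : realType) : numFieldType -> Prop :=
  | RealScalars : real_or_complex R R
  | ComplexScalars : real_or_complex R R[i].

(* Over the scalars at hand such a space is automatically complete, so
   finite-dimensional normed spaces and finite-dimensional Banach spaces are
   the same objects.  The vector-space structure also records a choice of
   coordinates, with no condition relating them to the norm; embeddings and
   isometries ignore it. *)
#[short(type="finDimNormedModType")]
HB.structure Definition FinDimNormedModule (K : numFieldType) :=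
  {V of NormedModule K V & Vector K V}.

Definition separable (T : topologicalType) : Prop :=
  exists2 D : set T, countable D & dense D.

Section Embeddings.
Variable K : numFieldType.

Record isometric_embedding (X Y : normedModType K) := IsometricEmbedding {
  isoemb_fun :> {linear X -> Y};
  isoemb_norm : forall x, `|isoemb_fun x| = `|x| }.

Definition linearly_isometric (X Y : normedModType K) : Prop :=
  exists f : isometric_embedding X Y, bijective f.

(* Norms take their values in K, also when K = R[i]; there 0 < eps
   forces eps to be real. *)
Definition eps_isometric_embedding (eps : K) (X Y : normedModType K)
    (f : {linear X -> Y}) : Prop :=
  forall x, (1 - eps) * `|x| <= `|f x| /\ `|f x| <= (1 + eps) * `|x|.

(* An inclusion of a normed subspace A of B is given as an isometric
   embedding of A into B, here and in the chains below. *)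
Definition gurarii_property (G : normedModType K) : Prop :=
  forall (eps : K), 0 < eps ->
  forall (A B : finDimNormedModType K) (i : isometric_embedding A B)
         (e : isometric_embedding A G),
  exists2 f : {linear B -> G},
    forall a, f (i a) = e a & eps_isometric_embedding eps f.

Definition is_the_gurarii_space (G : completeNormedModType K) : Prop :=
  [/\ separable G, gurarii_property G &
      forall H : completeNormedModType K,
        separable H -> gurarii_property H -> linearly_isometric H G].

End Embeddings.

Section Game.
Variable K : numFieldType.

Record chain := Chain {
  chain_space :> nat -> finDimNormedModType K;
  chain_incl : forall n,
    isometric_embedding (chain_space n) (chain_space n.+1) }.

(* [finite_chain n E] is the type of chains E_0 <= ... <= E_n with E_n = E. *)
Inductive finite_chain : nat -> finDimNormedModType K -> Type :=
  | ChainStart (E : finDimNormedModType K) : finite_chain 0 E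
  | ChainStep (n : nat) (E F : finDimNormedModType K) :
      finite_chain n E -> isometric_embedding E F -> finite_chain n.+1 F.

Fixpoint chain_prefix (E : chain) (n : nat) : finite_chain n (E n) :=
  match n with
  | 0 => ChainStart (E 0)
  | m.+1 => ChainStep (chain_prefix E m) (chain_incl E m)
  end.

Record extension (E : finDimNormedModType K) := Extension {
  ext_space : finDimNormedModType K;
  ext_incl : isometric_embedding E ext_space }.

Definition odd_strategy : Type :=
  forall (k : nat) (E : finDimNormedModType K),
    finite_chain k.*2 E -> extension E.

(* Eve's moves, including all the embeddings into them, are unconstrained. *)
Definition odd_uses (Sigma : odd_strategy) (E : chain) : Prop :=
  forall k, Extension (chain_incl E k.*2) = Sigma k _ (chain_prefix E k.*2).

(* U is the union (direct limit) of the chain, with the common norm. *)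
Definition is_chain_union (E : chain) (U : normedModType K) : Prop :=
  exists j : forall n, isometric_embedding (E n) U,
    (forall n x, j n.+1 (chain_incl E n x) = j n x) /\
    (forall u : U, exists n, exists x : E n, j n x = u).

Definition is_completion (U : normedModType K) (X : completeNormedModType K) :
    Prop :=
  exists i : isometric_embedding U X, dense (range i).

Definition leads_to (Sigma : odd_strategy) (G : completeNormedModType K) :
    Prop :=
  forall E : chain, odd_uses Sigma E ->
  exists (U : normedModType K) (X : completeNormedModType K),
    [/\ is_chain_union E U, is_completion U X & linearly_isometric X G].

End Game.

(* Main.v *)
Require Import Defs.
From HB Require Import structures.
From mathcomp Require Import all_boot all_order all_algebra.
From mathcomp Require Import all_classical all_reals topology normedtype.
From mathcomp Require Import complex lra zify.

(** Call a separable complete space with the Gurarii property a Gurarii space.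
    Three facts give the theorem:
    - a Gurarii space exists ([gurarii_space_ex]);
    - for every Gurarii space G, Odd has a strategy leading to G
      ([gurarii_strategy_leads_to]);
    - two strategies of Odd lead to isometric spaces ([leads_to_unique]).
    The last two also show that any two Gurarii spaces are isometric.

    Two strategies.  Let Eve open with any space and then follow the second
    strategy of Odd, applied to the chain deprived of its first member, while
    Odd follows the first one.  The resulting chain is a play for the first
    strategy, and without its first member a play for the second.  Dropping
    the first member does not change the limit, and the completion of the
    union of a chain is unique up to isometry ([chain_limit_unique]).

    A strategy leading to G.  Let y be a dense sequence in G.  Odd follows the
    play with linear maps g_k from E_2k to G that are isometric up to an error
    eps_k.  Let F be the finite-dimensional subspace of G spanned by the range
    of g_k and by y_0, ..., y_k.  Odd answers with a space containing both
    E_2k and F, in which every x of E_2k is at distance at most eps_k |x| from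
    g_k x ([amalgamation]).  Whatever Eve plays next, the Gurarii property
    extends the inclusion of F in G to a map g_(k+1) on E_(2k+2) which is
    isometric up to eps_(k+1); it has y_0, ..., y_k in its range, and its
    value at x in E_2k differs from g_k x by at most
    (1 + eps_(k+1)) eps_k |x| ([odd_move]).  With
    eps_k summable, the g_k converge to isometric embeddings of the spaces of
    the chain in G, and the union of their ranges is dense.

    Existence.  Up to small perturbations, a finite-dimensional space E has
    only countably many finite-dimensional extensions ([extension_net]): a
    seminorm on a fixed finite-dimensional space is determined, up to a small
    error, by its rounded values on a finite net of the unit ball
    ([seminorm_code]).  So there is a chain that realizes almost isometrically
    all finite-dimensional extensions of all its members
    ([saturated_chain_ex]): each of countably many tasks is pushed along the
    chain by amalgamation until its turn comes.  The limit of such a chain is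
    a Gurarii space ([saturated_limit_gurarii]).  Indeed, let A be included in
    B and e an isometric embedding of A in the limit; approximate e by a map
    into some E_n, amalgamate B with E_n along it, and map the amalgam back
    into the chain.  This gives an almost isometric map on B which almost
    extends e, and composing the small error with a linear projection of B
    onto A, which is bounded because B is finite-dimensional, corrects it into
    an exact extension.

    The real and the complex case are treated together by means of norms with
    real values ([nr]); what is needed of the scalars is collected in
    [scalar_field]. *)

Set Implicit Arguments.
Unset Strict Implicit.
Unset Printing Implicit Defensive.

Import Order.TTheory GRing.Theory Num.Theory.
Import numFieldNormedType.Exports.

Local Open Scope classical_set_scope.
Local Open Scope ring_scope.

(** * Real-valued norms and normed quotients *)

(** The order of a complex field is partial, while infima, upper limits and
    linear arithmetic are those of the reals: hence an embedding of R in K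
    whose range contains all nonnegative scalars, with a partial inverse
    [rpart].  The last field is the only topological fact about K that the
    proof uses. *)
Record scalar_field (R : realType) (K : numFieldType) := ScalarField {
  emb :> {rmorphism R -> K};
  rpart : K -> R;
  emb_le : forall a b, (emb a <= emb b) = (a <= b);
  rpartK : forall k, 0 <= k -> emb (rpart k) = k;
  unit_ball_precompact : exists2 B : set K, compact B & forall k, `|k| <= 1 -> B k }.

Section RealNorm.
Variables (R : realType) (K : numFieldType) (S : scalar_field R K).

Definition nr (V : normedZmodType K) (x : V) : R := rpart S `|x|.

Lemma emb_inj : injective S.
Proof. by move=> a b e; apply/le_anti; rewrite -!(emb_le S) e lexx. Qed.

Lemma emb_lt a b : (S a < S b) = (a < b).
Proof. by rewrite !lt_neqAle (emb_le S) (inj_eq emb_inj). Qed.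

Lemma embK a : 0 <= a -> rpart S (S a) = a.
Proof. by move=> a0; apply: emb_inj; rewrite rpartK// -(rmorph0 S) emb_le. Qed.

Section Norm.
Variable V : normedZmodType K.
Implicit Types x y z : V.

Lemma emb_nr x : S (nr x) = `|x|.
Proof. by rewrite rpartK. Qed.

Lemma nr_ge0 x : 0 <= nr x.
Proof. by rewrite -(emb_le S) rmorph0 emb_nr. Qed.

Lemma nrD x y : nr (x + y) <= nr x + nr y.
Proof. by rewrite -(emb_le S) rmorphD !emb_nr ler_normD. Qed.

Lemma nrN x : nr (- x) = nr x.
Proof. by rewrite /nr normrN. Qed.

Lemma nrC x y : nr (x - y) = nr (y - x).
Proof. by rewrite /nr distrC. Qed.

Lemma nr0 : nr (0 : V) = 0.
Proof. by apply: emb_inj; rewrite emb_nr rmorph0 normr0. Qed.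

Lemma nr_eq0 x : nr x = 0 -> x = 0.
Proof. by move=> x0; apply: normr0_eq0; rewrite -emb_nr x0 rmorph0. Qed.

Lemma nr_trans z x y : nr (x - y) <= nr (x - z) + nr (z - y).
Proof. by rewrite -[x - y](subrKA z) nrD. Qed.

Lemma nr_le_dist x y : nr x <= nr y + nr (x - y).
Proof. by rewrite addrC -[in leLHS](subrK y x) nrD. Qed.

Lemma nr_sum I (r : seq I) (P : pred I) (F : I -> V) :
  nr (\sum_(i <- r | P i) F i) <= \sum_(i <- r | P i) nr (F i).
Proof.
elim/big_ind2: _ => [|x a y b xa yb|//]; first by rewrite nr0.
exact: le_trans (nrD _ _) (lerD xa yb).
Qed.

End Norm.

Lemma nr_norm (V W : normedZmodType K) (x : V) (y : W) :
  nr x = nr y <-> `|x| = `|y|.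
Proof. by rewrite -!emb_nr; split=> [->//|/emb_inj]. Qed.

Lemma nr_emb a : 0 <= a -> nr (S a) = a.
Proof.
by move=> a0; rewrite /nr ger0_norm ?embK// -(rmorph0 S) emb_le.
Qed.

Lemma nrZ (V : normedModType K) (k : K) (x : V) : nr (k *: x) = nr k * nr x.
Proof. by apply: emb_inj; rewrite rmorphM !emb_nr normrZ. Qed.

Lemma nrM (k l : K) : nr (k * l) = nr k * nr l.
Proof. by apply: emb_inj; rewrite rmorphM !emb_nr normrM. Qed.

Lemma nr1 : nr (1 : K) = 1.
Proof. by rewrite -(rmorph1 S) nr_emb. Qed.

Lemma emb_pos (e : K) : 0 < e -> exists2 a, 0 < a & e = S a.
Proof.
move=> e0; exists (rpart S e); last by rewrite rpartK// ltW.
by rewrite -emb_lt rmorph0 rpartK ?ltW.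
Qed.

(** Seminorms are only asked for on a subset, because the two quotients below
    start from spaces of sequences on which the upper limit is a seminorm only
    for the well-behaved sequences. *)
Record is_seminorm_on (L : lmodType K) (A : set L) (p : L -> R) := SeminormOn {
  seminormD : forall x y, A x -> A y -> p (x + y) <= p x + p y;
  seminormZ : forall k x, A x -> p (k *: x) = nr k * p x }.

Definition is_seminorm (L : lmodType K) (p : L -> R) := is_seminorm_on setT p.

Section Seminorm.
Variables (L : lmodType K) (p : L -> R).
Hypothesis ps : is_seminorm p.

Lemma snD x y : p (x + y) <= p x + p y.
Proof. exact: (seminormD ps). Qed.

Lemma snZ k x : p (k *: x) = nr k * p x.
Proof. exact: (seminormZ ps). Qed.

Lemma sn0 : p 0 = 0.
Proof. by rewrite -(scale0r 0) snZ nr0 mul0r. Qed.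

Lemma snN x : p (- x) = p x.
Proof. by rewrite -scaleN1r snZ nrN nr1 mul1r. Qed.

Lemma sn_ge0 x : 0 <= p x.
Proof. by have := snD x (- x); rewrite subrr sn0 snN; lra. Qed.

Lemma sn_le_dist x y : p x <= p y + p (x - y).
Proof. by rewrite addrC -[in leLHS](subrK y x) snD. Qed.

Lemma sn_sum I (r : seq I) (F : I -> L) :
  p (\sum_(i <- r) F i) <= \sum_(i <- r) p (F i).
Proof.
elim/big_ind2: _ => [|x a y b xa yb|//]; first by rewrite sn0.
exact: le_trans (snD _ _) (lerD xa yb).
Qed.

End Seminorm.

Definition subspace_set (L : lmodType K) (A : set L) :=
  A 0 /\ forall k x y, A x -> A y -> A (k *: x + y).

Section Quotient.
Variables (L : lmodType K) (A : set L) (p : L -> R).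
Hypothesis (subA : subspace_set A) (pA : is_seminorm_on A p).

Let A0 : A 0. Proof. by case: subA. Qed.
Let AD x y : A x -> A y -> A (x + y).
Proof. by move=> Ax Ay; have := subA.2 1 _ _ Ax Ay; rewrite scale1r. Qed.
Let AZ k x : A x -> A (k *: x).
Proof. by move=> Ax; have := subA.2 k _ _ Ax A0; rewrite addr0. Qed.
Let AN x : A x -> A (- x).
Proof. by move=> Ax; rewrite -scaleN1r; apply: AZ. Qed.
Let AB x y : A x -> A y -> A (x - y).
Proof. by move=> Ax Ay; apply: AD => //; apply: AN. Qed.

Let p0 : p 0 = 0.
Proof. by have := seminormZ pA 0 A0; rewrite scale0r nr0 mul0r. Qed.
Let pN x : A x -> p (- x) = p x.
Proof. by move=> Ax; rewrite -scaleN1r (seminormZ pA)// nrN nr1 mul1r. Qed.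
Let p_ge0 x : A x -> 0 <= p x.
Proof.
move=> Ax; have := seminormD pA Ax (AN Ax).
by rewrite subrr p0 pN//; lra.
Qed.

Let eqv x y := `[< A y /\ p (x - y) = 0 >].

Let eqv_trans x y z : A x -> A z -> eqv x y -> eqv y z -> eqv x z.
Proof.
move=> Ax Az /asboolP[Ay xy] /asboolP[_ yz]; apply/asboolP; split=> //.
apply/le_anti; rewrite p_ge0 ?andbT; last exact: AB.
have := seminormD pA (AB Ax Ay) (AB Ay Az).
by rewrite subrKA xy yz addr0.
Qed.

Let eqv_sym x y : A x -> A y -> eqv x y -> eqv y x.
Proof.
by move=> Ax Ay /asboolP[_ xy]; apply/asboolP; rewrite -opprB pN//; exact: AB.
Qed.

Let eqv_refl x : A x -> eqv x x.
Proof. by move=> Ax; apply/asboolP; rewrite subrr p0. Qed.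

Let rep x := choose (eqv x) x.

Let repP x : A x -> eqv x (rep x).
Proof. by move=> Ax; apply: chooseP; apply: eqv_refl. Qed.

Let repA x : A x -> A (rep x).
Proof. by move=> /repP /asboolP[]. Qed.

Let rep_eq x y : A x -> A y -> eqv x y -> rep x = rep y.
Proof.
move=> Ax Ay xy; rewrite /rep.
have xyE : eqv x =1 eqv y.
  move=> z; have [Az|nAz] := pselect (A z); last first.
    by apply/idP/idP => /asboolP[].
  apply/idP/idP; last exact: eqv_trans.
  by apply: eqv_trans => //; apply: eqv_sym.
by rewrite (eq_choose xyE); apply: choose_id; [rewrite -xyE|]; exact: eqv_refl.
Qed.

Let rep_rep x : A x -> rep (rep x) = rep x.
Proof.
move=> Ax; symmetry; apply: rep_eq => //; [exact: repA|exact: repP].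
Qed.

Let repE x y : A x -> A y -> rep x = rep y <-> p (x - y) = 0.
Proof.
move=> Ax Ay; split=> [e|e]; last by apply: rep_eq => //; apply/asboolP.
have yr := eqv_sym Ay (repA Ay) (repP Ay).
have xr := repP Ax; rewrite e in xr.
by have /asboolP[] := eqv_trans Ax Ay xr yr.
Qed.

(** A class is represented by the element that the choice operator picks in
    it, so that equality of classes is equality of representatives. *)
Definition quot := {x : L | `[< A x /\ rep x = x >]}.

HB.instance Definition _ := gen_eqMixin quot.
HB.instance Definition _ := gen_choiceMixin quot.

Let proj (x : L) (Ax : A x) : quot.
Proof. by exists (rep x); apply/asboolP; split; [exact: repA|exact: rep_rep]. Defined.

Let lift (u : quot) : A (sval u).
Proof. by case: u => x /= /asboolP[]. Qed.

Let projK (u : quot) : proj (lift u) = u.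
Proof.
apply: val_inj => /=; by case: u => x /= xP; case/asboolP: (xP).
Qed.

Let proj_eq x y (Ax : A x) (Ay : A y) : p (x - y) = 0 -> proj Ax = proj Ay.
Proof. by move=> e; apply: val_inj => /=; apply/(repE Ax Ay). Qed.

Let liftP x (Ax : A x) : p (sval (proj Ax) - x) = 0.
Proof.
by rewrite /=; apply/repE => //; [exact: repA|exact: rep_rep].
Qed.

Let projP (u : quot) : exists x, exists Ax : A x, u = proj Ax.
Proof. by exists (sval u), (lift u); rewrite projK. Qed.

Let add (u v : quot) := proj (AD (lift u) (lift v)).
Let scale k (u : quot) := proj (AZ k (lift u)).
Let opp (u : quot) := proj (AN (lift u)).
Let zero : quot := proj A0.

Let p_eq0D x y : A x -> A y -> p x = 0 -> p y = 0 -> p (x + y) = 0.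
Proof.
move=> Ax Ay ex ey; apply/le_anti; rewrite p_ge0 ?andbT; last exact: AD.
by have := seminormD pA Ax Ay; rewrite ex ey addr0.
Qed.

Let addE x y (Ax : A x) (Ay : A y) : add (proj Ax) (proj Ay) = proj (AD Ax Ay).
Proof.
apply: proj_eq; rewrite opprD addrACA.
by apply: p_eq0D; rewrite ?liftP//; apply: AB => //; apply: lift.
Qed.

Let scaleE k x (Ax : A x) : scale k (proj Ax) = proj (AZ k Ax).
Proof.
apply: proj_eq; rewrite -scalerBr (seminormZ pA) ?liftP ?mulr0//.
by apply: AB => //; apply: lift.
Qed.

Let oppE x (Ax : A x) : opp (proj Ax) = proj (AN Ax).
Proof.
apply: proj_eq; rewrite -opprD pN ?liftP//.
by apply: AB => //; apply: lift.
Qed.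

Let proj_ext x y (Ax : A x) (Ay : A y) : x = y -> proj Ax = proj Ay.
Proof. by move=> e; apply: proj_eq; rewrite e subrr. Qed.

Let quot_addA : associative add.
Proof.
move=> u v w; have [x [Ax ->]] := projP u; have [y [Ay ->]] := projP v.
have [z [Az ->]] := projP w; rewrite !addE; apply: proj_ext; exact: addrA.
Qed.
Let quot_addC : commutative add.
Proof.
move=> u v; have [x [Ax ->]] := projP u; have [y [Ay ->]] := projP v.
rewrite !addE; apply: proj_ext; exact: addrC.
Qed.
Let quot_add0 : left_id zero add.
Proof.
move=> u; have [x [Ax ->]] := projP u; rewrite addE; apply: proj_ext.
exact: add0r.
Qed.
Let quot_addN : left_inverse zero opp add.
Proof.
move=> u; have [x [Ax ->]] := projP u; rewrite oppE addE; apply: proj_ext.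
exact: addNr.
Qed.

HB.instance Definition _ :=
  GRing.isZmodule.Build quot quot_addA quot_addC quot_add0 quot_addN.

Let quot_scaleA a b (u : quot) : scale a (scale b u) = scale (a * b) u.
Proof.
have [x [Ax ->]] := projP u; rewrite !scaleE; apply: proj_ext.
exact: scalerA.
Qed.
Let quot_scale1 : left_id 1 scale.
Proof.
move=> u; have [x [Ax ->]] := projP u; rewrite scaleE; apply: proj_ext.
exact: scale1r.
Qed.
Let quot_scaleDr : right_distributive scale +%R.
Proof.
move=> a u v; have [x [Ax ->]] := projP u; have [y [Ay ->]] := projP v.
rewrite /GRing.add /= !(addE, scaleE); apply: proj_ext; exact: scalerDr.
Qed.
Let quot_scaleDl (u : quot) : {morph scale^~ u: a b / a + b}.
Proof.
move=> a b; have [x [Ax ->]] := projP u.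
rewrite /GRing.add /= !(addE, scaleE); apply: proj_ext; exact: scalerDl.
Qed.

HB.instance Definition _ := GRing.Zmodule_isLmodule.Build K quot
  quot_scaleA quot_scale1 quot_scaleDr quot_scaleDl.

Let norm (u : quot) : K := S (p (sval u)).

Let normE x (Ax : A x) : norm (proj Ax) = S (p x).
Proof.
apply: (congr1 S); set y := sval _; have Ay : A y := lift _; have xy := liftP Ax.
apply/le_anti/andP; split.
  have := seminormD pA (AB Ay Ax) Ax; rewrite subrK.
  by rewrite xy add0r.
have := seminormD pA (AB Ax Ay) Ay; rewrite subrK.
by rewrite -opprB pN ?xy ?add0r//; exact: AB.
Qed.

Let quot_normD (u v : quot) : norm (u + v) <= norm u + norm v.
Proof.
have [x [Ax ->]] := projP u; have [y [Ay ->]] := projP v.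
have -> : proj Ax + proj Ay = proj (AD Ax Ay) by exact: addE.
by rewrite !normE -rmorphD emb_le; exact: (seminormD pA).
Qed.

Let quot_normZ k (u : quot) : norm (k *: u) = `|k| * norm u.
Proof.
have [x [Ax ->]] := projP u.
have -> : k *: proj Ax = proj (AZ k Ax) by exact: scaleE.
by rewrite !normE (seminormZ pA)// rmorphM emb_nr.
Qed.

Let quot_norm_eq0 (u : quot) : norm u = 0 -> u = 0.
Proof.
have [x [Ax ->]] := projP u; rewrite normE -(rmorph0 S) => /emb_inj px.
by apply: proj_eq; rewrite subr0.
Qed.

HB.instance Definition _ :=
  Lmodule_isNormed.Build K quot quot_normD quot_normZ quot_norm_eq0.

(** Both the union of a chain and the completion of a space are instances:
    threads, respectively Cauchy sequences, modulo those of seminorm 0. *)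
Lemma normed_quotient : exists (U : normedModType K) (q : L -> U),
  [/\ forall k x y, A x -> A y -> q (k *: x + y) = k *: q x + q y,
      forall x, A x -> nr (q x) = p x
    & forall u, exists2 x, A x & q x = u].
Proof.
pose q (x : L) : quot := match pselect (A x) with
  | left Ax => proj Ax | right _ => 0 end.
have qE x (Ax : A x) : q x = proj Ax.
  by rewrite /q; case: pselect => // Ax'; exact: proj_ext.
exists quot, q; split.
- move=> k x y Ax Ay; rewrite (qE _ (AD (AZ k Ax) Ay)) (qE _ Ax) (qE _ Ay).
  have -> : k *: proj Ax = proj (AZ k Ax) by exact: scaleE.
  by symmetry; exact: addE.
- move=> x Ax; rewrite (qE _ Ax); apply: emb_inj; rewrite emb_nr.
  exact: normE.
- by move=> u; have [x [Ax ->]] := projP u; exists x => //; exact: qE.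
Qed.

End Quotient.
End RealNorm.

(** * Linear isometries, finite-dimensional spaces and amalgamation *)

Section Maps.
Variables (R : realType) (K : numFieldType) (S : scalar_field R K).

(** Its underlying function is convertible to f, so that a statement about f
    applies to it without rewriting. *)
Definition mk_linear (X Y : lmodType K) (f : X -> Y) (flin : linear f) :
  {linear X -> Y} := HB.pack f (GRing.isLinear.Build K X Y *:%R f flin).

Definition near_isometry (X Y : normedModType K) (d : R) (f : X -> Y) :=
  forall x, (1 - d) * nr S x <= nr S (f x) <= (1 + d) * nr S x.

Section TwoSpaces.
Variables X Y : normedModType K.

Definition mk_iso (f : X -> Y) (flin : linear f)
    (fnr : forall x, nr S (f x) = nr S x) : isometric_embedding X Y :=
  @IsometricEmbedding _ _ _ (mk_linear flin)
    (fun x => (nr_norm S (f x) x).1 (fnr x)).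

Lemma iso_nr (f : isometric_embedding X Y) x : nr S (f x) = nr S x.
Proof. by apply/nr_norm; apply: isoemb_norm. Qed.

Lemma iso_inj (f : isometric_embedding X Y) : injective f.
Proof.
move=> x y e; apply/eqP; rewrite -subr_eq0; apply/eqP/(@nr_eq0 _ _ S).
by rewrite -(iso_nr f) linearB e subrr nr0.
Qed.

Lemma near_isometryP d (f : {linear X -> Y}) :
  eps_isometric_embedding (S d) f <-> near_isometry d f.
Proof.
split=> H x.
  have [] := H x; rewrite -!(emb_nr S) -(rmorph1 S) -rmorphB -rmorphD -!rmorphM.
  by rewrite !emb_le => -> ->.
have := H x; rewrite -!(emb_nr S) -(rmorph1 S) -rmorphB -rmorphD -!rmorphM.
by rewrite !emb_le => /andP.
Qed.

End TwoSpaces.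

Lemma comp_linear (X Y Z : lmodType K) (f : {linear X -> Y})
  (g : {linear Y -> Z}) : linear (g \o f).
Proof. by move=> k x y /=; rewrite !linearP. Qed.

Definition lcomp (X Y Z : lmodType K) (g : {linear Y -> Z})
  (f : {linear X -> Y}) : {linear X -> Z} := mk_linear (comp_linear f g).

Definition iso_comp (X Y Z : normedModType K) (g : isometric_embedding Y Z)
    (f : isometric_embedding X Y) : isometric_embedding X Z :=
  @mk_iso X Z (g \o f) (comp_linear f g)
    (fun x => etrans (iso_nr g (f x)) (iso_nr f x)).

Lemma id_linear (X : lmodType K) : linear (@id X).
Proof. by []. Qed.

Definition iso_id (X : normedModType K) : isometric_embedding X X :=
  @mk_iso X X id (@id_linear X) (fun x => erefl).

End Maps.

Section FiniteDimension.
Variables (R : realType) (K : numFieldType) (S : scalar_field R K).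

Section NormedVect.
Variables (V : vectType K) (p : V -> R).
Hypotheses (ps : is_seminorm S p) (p_eq0 : forall x, p x = 0 -> x = 0).

Definition normed_vect : Type := V.
HB.instance Definition _ := Vector.on normed_vect.

Let norm (x : normed_vect) : K := S (p x).
Let normD (x y : normed_vect) : norm (x + y) <= norm x + norm y.
Proof. by rewrite -rmorphD emb_le; exact: snD ps _ _. Qed.
Let normZ k (x : normed_vect) : norm (k *: x) = `|k| * norm x.
Proof. by rewrite /norm (snZ ps) rmorphM emb_nr. Qed.
Let norm_eq0 (x : normed_vect) : norm x = 0 -> x = 0.
Proof. by rewrite /norm -(rmorph0 S) => /emb_inj/p_eq0. Qed.

HB.instance Definition _ :=
  Lmodule_isNormed.Build K normed_vect normD normZ norm_eq0.

(** Makes a normed space of a vector space without exposing the structure on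
    the type of its elements; q and s are both the identity. *)
Lemma normed_vect_ex : exists (W : finDimNormedModType K)
  (q : {linear V -> W}) (s : {linear W -> V}),
  [/\ cancel s q, cancel q s & forall x, nr S (q x) = p x].
Proof.
exists (normed_vect : finDimNormedModType K).
exists (mk_linear (@id_linear K V) : {linear V -> normed_vect}).
exists (mk_linear (@id_linear K V) : {linear normed_vect -> V}).
by split=> // x; apply: (@emb_inj _ _ S); rewrite emb_nr.
Qed.

End NormedVect.

(** A subspace of largest dimension on which p vanishes absorbs every vector
    on which p vanishes. *)
Lemma seminorm_kernel (V : vectType K) (p : V -> R) : is_seminorm S p ->
  exists U : {vspace V}, forall x, x \in U <-> p x = 0.
Proof.
move=> ps.
pose P n := `[< exists U : {vspace V}, \dim U = n /\ forall x, x \in U -> p x = 0 >].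
have Pex : exists n, P n.
  exists 0%N; apply/asboolP; exists 0%VS; split; first exact: dimv0.
  by move=> x; rewrite memv0 => /eqP ->; exact: sn0 ps.
have Ple n : P n -> (n <= \dim (fullv : {vspace V}))%N.
  by move=> /asboolP[U [<- _]]; apply: dimvS; apply: subvf.
have [n /asboolP[U [dU U0]] nmax] := ex_maxnP Pex Ple.
exists U => x; split; first exact: U0.
move=> px; apply: contrapT => /negP xU.
have /nmax : P (\dim (U + <[x]>)%VS).
  apply/asboolP; exists (U + <[x]>)%VS; split=> // y.
  move=> /memv_addP[u uU [v /vlineP[k ->] ->]].
  apply/le_anti; rewrite (sn_ge0 ps) andbT.
  apply: le_trans (snD ps _ _) _.
  by rewrite (snZ ps) px U0// mulr0 addr0.
rewrite -dU leqNgt => /negP; apply.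
rewrite ltn_neqAle dimvS ?addvSl// andbT; apply/negP => /eqP e.
have : (U == U + <[x]>)%VS by rewrite eqEdim addvSl e leqnn.
move/eqP => eU; move/negP: xU; apply; rewrite eU.
by apply: (subvP (addvSr U <[x]>)); exact: memv_line.
Qed.

(** The quotient is realized on a complement of the kernel of p, which also
    gives a linear section.  Thanks to this lemma the constructions below only
    have to produce seminorms. *)
Lemma seminorm_separation (V : vectType K) (p : V -> R) : is_seminorm S p ->
  exists (W : finDimNormedModType K) (q : {linear V -> W}) (s : {linear W -> V}),
  cancel s q /\ forall x, nr S (q x) = p x.
Proof.
move=> ps; have [U UP] := seminorm_kernel ps.
pose W := subvs_of (U^C)%VS.
pose r (w : W) := p (vsval w).
have rs : is_seminorm S r.
  split=> [x y _ _|k x _]; rewrite /r ?linearD ?linearZ.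
    exact: snD ps _ _.
  exact: snZ ps _ _.
have UC0 : (U^C :&: U = 0)%VS by rewrite capvC capv_compl.
have r0 x : r x = 0 -> x = 0.
  move/UP => xU; apply: val_inj => /=; apply/eqP; rewrite -memv0 -UC0.
  by rewrite memv_cap xU andbT; exact: subvsP.
have [W' [q [s [sK qK qp]]]] := normed_vect_ex rs r0.
have tlin : linear (fun x : V => vsproj (U^C)%VS (daddv_pi (U^C)%VS U x)).
  by move=> k x y; rewrite !linearP.
pose t := mk_linear tlin.
have tE x : vsval (t x) = daddv_pi (U^C)%VS U x.
  by rewrite /= vsprojK//; exact: memv_pi.
pose v : {linear W -> V} := mk_linear (fun k x y => linearP vsval k x y).
exists W', (lcomp q t), (lcomp v s).
split=> [w|x].
  rewrite /=; set x := s w.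
  have -> : vsproj (U^C)%VS (daddv_pi (U^C)%VS U (vsval x)) = x.
    by rewrite daddv_pi_id ?subvsP// vsvalK.
  by rewrite sK.
rewrite qp /r tE.
have xE : x = daddv_pi (U^C)%VS U x + daddv_pi U (U^C)%VS x.
  rewrite daddv_pi_add ?capv_compl//.
  by rewrite addvC addv_complf memvf.
set a := daddv_pi _ _ x in xE *.
set b := daddv_pi _ _ x in xE.
have pb : p b = 0 by apply/UP; exact: memv_pi.
apply/le_anti/andP; split.
  have -> : a = x + (-1) *: b by rewrite scaleN1r xE addrK.
  apply: le_trans (snD ps _ _) _.
  by rewrite (snZ ps) pb mulr0 addr0.
rewrite {1}xE; apply: le_trans (snD ps _ _) _.
by rewrite pb addr0.
Qed.

(** An infimal projection of a seminorm of two variables: the quotient seminorm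
    on V of P modulo X. *)
Lemma infimal_seminorm (X V : lmodType K) (P : X -> V -> R) :
    (forall a v, 0 <= P a v) ->
    (forall a b v w, P (a + b) (v + w) <= P a v + P b w) ->
    (forall k a v, P (k *: a) (k *: v) = nr S k * P a v) ->
  exists2 p : V -> R, is_seminorm S p &
    (forall a v, p v <= P a v) /\
    (forall c v, (forall a, c <= P a v) -> c <= p v).
Proof.
move=> P0 PD PZ.
pose p v := inf [set P a v | a in setT].
have ple a v : p v <= P a v.
  by apply: ge_inf; [exists 0 => _ [b _ <-]|exists a].
have lep c v : (forall a, c <= P a v) -> c <= p v.
  move=> H; apply: lb_le_inf; first by exists (P 0 v); exists 0.
  by move=> _ [b _ <-].
have pZle k v : k != 0 -> p (k *: v) <= nr S k * p v.
  move=> k0; have k_gt0 : 0 < nr S k.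
    rewrite lt_neqAle nr_ge0 andbT eq_sym; apply: contra_neq k0.
    exact: nr_eq0.
  rewrite -ler_pdivrMl//; apply: (lep) => a.
  by rewrite ler_pdivrMl// -PZ.
exists p; last by split.
split=> [x y _ _|k x _].
  rewrite -lerBlDl; apply: (lep) => b.
  suff : p (x + y) - P b y <= p x by lra.
  apply: (lep) => a; rewrite lerBlDr; apply: le_trans (ple (a + b) _) _.
  exact: PD.
have [->|k0] := eqVneq k 0.
  rewrite scale0r nr0 mul0r; apply/le_anti/andP; split.
    apply: le_trans (ple 0 _) _.
    by have := PZ 0 0 0; rewrite !scale0r nr0 mul0r => ->.
  exact: lep.
apply/le_anti; rewrite pZle//=.
have := pZle k^-1 (k *: x); rewrite invr_eq0 => /(_ k0).
rewrite scalerA mulVf// scale1r => H.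
rewrite -[leRHS]mul1r -(nr1 S) -(mulfV k0) nrM -mulrA.
by apply: ler_wpM2l => //; exact: nr_ge0.
Qed.

(** The sum of B and E carries the seminorm
    p(b, x) = inf_a (|b - i a| + |x + e a| + d |a|).  Since i a costs |a| and
    e a costs at least (1 - d) |a| and at most (1 + d) |a|, moving a vector a
    from one summand to the other never pays, so p extends both norms; taking
    the infimum at a itself bounds p(i a, - e a) by d |a|.  For d = 0 this is
    the usual pushout. *)
Lemma amalgamation (A B E : finDimNormedModType K)
    (i : isometric_embedding A B) (e : {linear A -> E}) (d : R) :
    0 <= d -> near_isometry S d e ->
  exists (W : finDimNormedModType K) (b : isometric_embedding B W)
    (c : isometric_embedding E W), forall a, nr S (b (i a) - c (e a)) <= d * nr S a.
Proof.
move=> d0 ed.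
pose P (a : A) (v : (B * E)%type) := nr S (v.1 - i a) + nr S (v.2 + e a) + d * nr S a.
have P0 a v : 0 <= P a v by rewrite !addr_ge0 ?mulr_ge0 ?nr_ge0.
have PD a a' v w : P (a + a') (v + w) <= P a v + P a' w.
  rewrite /P /= !linearD /= [v.1 + _ + _]addrACA [v.2 + _ + _]addrACA.
  have H1 := nrD S (v.1 - i a) (w.1 - i a').
  have H2 := nrD S (v.2 + e a) (w.2 + e a').
  have := ler_wpM2l d0 (nrD S a a'); lra.
have PZ k a v : P (k *: a) (k *: v) = nr S k * P a v.
  by rewrite /P /= !linearZ /= -!scalerDr !nrZ mulrCA !mulrDr.
have [p ps [ple lep]] := infimal_seminorm P0 PD PZ.
have [W [q [s [_ qp]]]] := seminorm_separation ps.
have blin : linear (fun b : B => q (b, 0)).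
  by move=> k x y; rewrite -linearP; congr (q (_, _)); rewrite /= scaler0 addr0.
have clin : linear (fun c : E => q (0, c)).
  by move=> k x y; rewrite -linearP; congr (q (_, _)); rewrite /= scaler0 addr0.
have bnr x : nr S (q (x, 0)) = nr S x.
  rewrite qp; apply/le_anti/andP; split.
    by apply: le_trans (ple 0 _) _; rewrite /P /= !(linear0, subr0, add0r, addr0, nr0, mulr0).
  apply: (lep) => a; rewrite /P /= add0r.
  have := nr_le_dist S x (i a); rewrite iso_nr; have /andP[] := ed a; lra.
have cnr x : nr S (q (0, x)) = nr S x.
  rewrite qp; apply/le_anti/andP; split.
    by apply: le_trans (ple 0 _) _; rewrite /P /= !(linear0, subr0, add0r, addr0, nr0, mulr0).
  apply: (lep) => a; rewrite /P /= add0r nrN iso_nr.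
  have := nr_le_dist S x (- e a); rewrite nrN opprK; have /andP[] := ed a; lra.
exists W, (mk_iso blin bnr), (mk_iso clin cnr) => a.
rewrite /= -linearB qp; apply: le_trans (ple a _) _.
by rewrite /P /= subr0 subrr sub0r addNr !nr0 !add0r.
Qed.

End FiniteDimension.

(** * Sequential completeness and completions *)

Section RealSequences.
Variable R : realType.

Definition recip (n : nat) : R := n.+1%:R^-1.

Lemma recip_gt0 n : 0 < recip n.
Proof. by rewrite invr_gt0 ltr0n. Qed.

Lemma recip_small (e : R) :
  0 < e -> exists N, forall n, (N <= n)%N -> recip n <= e.
Proof.
move=> e0; exists (Num.truncn e^-1) => n Nn; rewrite /recip.
have n0 : (0 : R) < n.+1%:R by rewrite ltr0n.
rewrite -(invrK e) lef_pV2 ?posrE ?invr_gt0//.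
have /truncn_itv/andP[_ /ltW/le_trans] : 0 <= e^-1 by rewrite invr_ge0 ltW.
by apply; rewrite ler_nat.
Qed.

(** Unlike a limit, this is defined for every sequence, and it is subadditive
    and homogeneous on nonnegative bounded sequences without any convergence. *)
Definition limsup (s : nat -> R) : R :=
  inf [set r | exists N, forall n, (N <= n)%N -> s n <= r].

(** Guards [limsup] against the infimum of the empty set. *)
Definition ev_bounded (s : nat -> R) := exists r N, forall n, (N <= n)%N -> s n <= r.

Lemma limsup_le s r : (forall n, 0 <= s n) ->
  (exists N, forall n, (N <= n)%N -> s n <= r) -> limsup s <= r.
Proof.
move=> s0 H; apply: ge_inf => //; exists 0 => t [N HN].
by apply: le_trans (HN N _).
Qed.

Lemma le_limsup s c : ev_bounded s ->
  (forall r, (exists N, forall n, (N <= n)%N -> s n <= r) -> c <= r) ->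
  c <= limsup s.
Proof. by move=> [r H] Hc; apply: lb_le_inf => //; exists r. Qed.

Lemma limsupD s t u : (forall n, 0 <= u n) -> ev_bounded s -> ev_bounded t ->
  (forall n, u n <= s n + t n) -> limsup u <= limsup s + limsup t.
Proof.
move=> u0 bs bt ust; rewrite -lerBlDl; apply: le_limsup => // r [N HN].
suff : limsup u - r <= limsup s by lra.
apply: le_limsup => // r' [N' HN']; rewrite lerBlDr; apply: limsup_le => //.
exists (maxn N N') => n; rewrite geq_max => /andP[Nn N'n].
by apply: le_trans (ust n) _; apply: lerD; [exact: HN'|exact: HN].
Qed.

Lemma limsupZ k s : 0 <= k -> (forall n, 0 <= s n) -> ev_bounded s ->
  limsup (fun n => k * s n) = k * limsup s.
Proof.
move=> k0 s0 bs; have [r0 [N0 bs0]] := bs.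
have ks0 n : 0 <= k * s n by rewrite mulr_ge0.
have bks : ev_bounded (fun n => k * s n).
  by exists (k * r0), N0 => n Nn; rewrite ler_wpM2l// bs0.
have [->|k1] := eqVneq k 0.
  rewrite mul0r; apply/le_anti/andP; split.
    by apply: limsup_le => [n|]; [rewrite mul0r|exists 0%N => n; rewrite mul0r].
  apply: le_limsup => [|r [N]].
    by exists 0, 0%N => n; rewrite mul0r.
  by move/(_ N (leqnn _)); rewrite mul0r.
have kp : 0 < k by rewrite lt_neqAle eq_sym k1.
apply/le_anti/andP; split.
  rewrite -ler_pdivrMl//; apply: le_limsup => // r [N HN].
  rewrite ler_pdivrMl//; apply: limsup_le => //.
  by exists N => n Nn; rewrite ler_wpM2l// HN.
apply: le_limsup => // r [N HN]; rewrite -ler_pdivlMl//; apply: limsup_le => //.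
by exists N => n Nn; rewrite ler_pdivlMl// HN.
Qed.

Lemma limsup_ev s c : (forall n, 0 <= s n) ->
  (exists N, forall n, (N <= n)%N -> s n = c) -> limsup s = c.
Proof.
move=> s0 [N H]; apply/le_anti/andP; split.
  by apply: limsup_le => //; exists N => n Nn; rewrite H.
apply: le_limsup; first by exists c, N => n Nn; rewrite H.
move=> r [N' H']; rewrite -(H (maxn N N')) ?leq_maxl//.
by apply: H'; rewrite leq_maxr.
Qed.

End RealSequences.

Section Completeness.
Variables (R : realType) (K : numFieldType) (S : scalar_field R K).

Definition nr_cauchy (V : normedModType K) (a : nat -> V) :=
  forall e, 0 < e -> exists N, forall m n, (N <= m)%N -> (N <= n)%N ->
    nr S (a m - a n) <= e.

Definition nr_cvg (V : normedModType K) (a : nat -> V) (l : V) :=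
  forall e, 0 < e -> exists N, forall n, (N <= n)%N -> nr S (a n - l) <= e.

Definition nr_dense (V : normedModType K) (D : set V) :=
  forall x e, 0 < e -> exists2 y, D y & nr S (x - y) <= e.

Lemma ball_nr (V : normedModType K) (x y : V) (e : R) :
  ball x (S e) y <-> nr S (x - y) < e.
Proof. by rewrite -ball_normE /= -(emb_nr S) emb_lt. Qed.

Lemma nr_denseP (V : normedModType K) (D : set V) : dense D <-> nr_dense D.
Proof.
split=> [dD x e e0|dD O [x Ox] oO].
  have Se0 : 0 < S e by rewrite -(rmorph0 S) emb_lt.
  have nb : nbhs x (ball x (S e)) by exact: nbhsx_ballx.
  have [|//|y []] := dD (interior (ball x (S e))).
  - by exists x.
  - exact: open_interior.
  - by move=> /interior_subset/ball_nr/ltW ? ?; exists y.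
have /nbhs_ballP[e /= e0 He] : nbhs x O by exact: open_nbhs_nbhs.
have [a a0 ea] := emb_pos S e0.
have [|y Dy xy] := dD x (a / 2); first by rewrite divr_gt0.
exists y; split=> //; apply: He; rewrite ea; apply/ball_nr.
by apply: le_lt_trans xy _; lra.
Qed.

Lemma complete_nr_cvg (X : completeNormedModType K) (a : nat -> X) :
  nr_cauchy a -> exists l, nr_cvg a l.
Proof.
move=> ca; have : cvg (a @ \oo).
  apply: cauchy_cvg; apply: cauchy_exP => e e0.
  have [b b0 ->] := emb_pos S e0.
  have [|N HN] := ca (b / 2); first by rewrite divr_gt0.
  exists (a N), N => // n /= Nn; apply/ball_nr.
  by apply: le_lt_trans (HN _ _ _ _) _ => //; lra.
move=> /cvg_ex[l al]; exists l => e e0.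
have Se0 : 0 < S e by rewrite -(rmorph0 S) emb_lt.
have [N _ HN] := al _ (nbhsx_ballx l _ Se0).
by exists N => n Nn; rewrite nrC; apply/ltW/ball_nr/HN.
Qed.

Section Complete.
Variable U : normedModType K.
Hypothesis Uc : forall a : nat -> U, nr_cauchy a -> exists l, nr_cvg a l.

Definition complete_space : Type := U.
HB.instance Definition _ := NormedModule.on complete_space.

(** A space in which Cauchy sequences converge is complete for Cauchy filters:
    points chosen in sets of the filter of radius 1 / (n + 1) form a Cauchy
    sequence with the same limit. *)
Let complete (F : set_system complete_space) : ProperFilter F -> cauchy F -> cvg F.
Proof.
move=> FF /cauchyP Fc.
have Sp n : 0 < S (recip R n) by rewrite -(rmorph0 S) emb_lt recip_gt0.
have /choice[x Fx] : forall n, exists x : complete_space, F (ball x (S (recip R n))).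
  by move=> n; apply: Fc.
have xx m n : nr S (x m - x n) <= recip R m + recip R n.
  have [z [/ball_nr zm /ball_nr zn]] := filter_ex (filterI (Fx m) (Fx n)).
  apply: le_trans (nr_trans S z _ _) _; rewrite (nrC S z).
  by rewrite lerD// ltW.
have [e e0|l xl] := Uc (a := x).
  have [|N HN] := @recip_small R (e / 2); first by rewrite divr_gt0.
  exists N => m n Nm Nn; apply: le_trans (xx m n) _.
  have := HN _ Nm; have := HN _ Nn; lra.
apply/cvg_ex; exists (l : complete_space) => A /nbhs_ballP[e /= e0 lA].
have [b b0 eb] := emb_pos S e0.
have b4 : 0 < b / 4 by rewrite divr_gt0.
have [N HN] := recip_small b4; have [N' HN'] := xl _ b4.
pose n := maxn N N'.
apply: filterS (Fx n) => z /ball_nr zn; apply: lA; rewrite eb; apply/ball_nr.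
apply: le_lt_trans (nr_trans S (x n) _ _) _; rewrite (nrC S l).
have := HN n (leq_maxl _ _); have := HN' n (leq_maxr _ _); lra.
Qed.

HB.instance Definition _ := Uniform_isComplete.Build complete_space complete.

Lemma complete_space_ex : exists (X : completeNormedModType K)
  (f : isometric_embedding U X), bijective f.
Proof.
exists complete_space.
exists (@IsometricEmbedding _ U complete_space (mk_linear (@id_linear K U)) (fun=> erefl)).
by exists id.
Qed.

End Complete.

Lemma cauchy_bounded (V : normedModType K) (a : nat -> V) :
  nr_cauchy a -> ev_bounded (fun n => nr S (a n)).
Proof.
move=> /(_ 1 ltr01)[N HN]; exists (nr S (a N) + 1), N => n Nn.
by apply: le_trans (nr_le_dist S _ (a N)) _; rewrite lerD2l HN.
Qed.

(** Cauchy sequences modulo null sequences, with the upper limit of the norms.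
    A Cauchy sequence of classes is approximated by a sequence of constants,
    whose entries form a Cauchy sequence of V; the class of that sequence is
    the limit. *)
Lemma normed_completion (V : normedModType K) :
  exists (X : completeNormedModType K) (i : isometric_embedding V X),
    nr_dense (range i).
Proof.
pose A : set (nat -> V) := [set a | nr_cauchy a].
pose p (a : nat -> V) := limsup (fun n => nr S (a n)).
have subA : subspace_set A.
  split=> [e e0|k x y Ax Ay e e0].
    by exists 0%N => m n _ _; rewrite subrr nr0 ltW.
  have k1 : 0 < nr S k + 1 by rewrite ltr_wpDl ?nr_ge0.
  have [|N HN] := Ax (e / 2 / (nr S k + 1)); first by rewrite !divr_gt0.
  have [|N' HN'] := Ay (e / 2); first by rewrite divr_gt0.
  exists (maxn N N') => m n; rewrite !geq_max => /andP[Nm N'm] /andP[Nn N'n].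
  have -> : (k *: x + y) m - (k *: x + y) n = k *: (x m - x n) + (y m - y n).
    by rewrite scalerBr addrACA -opprD.
  apply: le_trans (nrD _ _ _) _; rewrite nrZ.
  have := HN' _ _ N'm N'n; have := HN _ _ Nm Nn.
  rewrite ler_pdivlMr// mulrDr mulr1.
  have := nr_ge0 S (x m - x n); rewrite mulrC; lra.
have pA : is_seminorm_on S A p.
  split=> [x y Ax Ay|k x Ax].
    apply: limsupD => [n|||n]; [exact: nr_ge0|exact: cauchy_bounded..|exact: nrD].
  rewrite /p -limsupZ ?nr_ge0//; last 2 first.
  - by move=> n; exact: nr_ge0.
  - exact: cauchy_bounded.
  by congr limsup; apply/funext => n; rewrite nrZ.
have [U [q [qlin qp qsurj]]] := normed_quotient subA pA.
pose c (x : V) : nat -> V := fun=> x.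
have Ac x : A (c x) by move=> e e0; exists 0%N => m n _ _; rewrite subrr nr0 ltW.
have ilin : linear (fun x => q (c x)).
  by move=> k x y; rewrite -qlin.
have inr x : nr S (q (c x)) = nr S x.
  rewrite qp//; apply: limsup_ev => [n|]; first exact: nr_ge0.
  by exists 0%N.
have qB x y : A x -> A y -> q x - q y = q (x - y).
  move=> Ax Ay; rewrite addrC -scaleN1r -qlin//; congr q.
  by rewrite scaleN1r addrC.
have AB x y : A x -> A y -> A (x - y).
  by move=> Ax Ay; rewrite addrC -scaleN1r; apply: subA.2.
have dense_i u e : 0 < e -> exists x, nr S (u - q (c x)) <= e.
  move=> e0; have [a Aa <-] := qsurj u; have [N HN] := Aa _ e0.
  exists (a N); rewrite qB// qp; last exact: AB.
  apply: limsup_le => [n|]; first exact: nr_ge0.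
  by exists N => n Nn; apply: HN.
have [u uc|X [f [g fK gK]]] := @complete_space_ex U.
  have /choice[x Hx] : forall n, exists x, nr S (u n - q (c x)) <= recip R n.
    by move=> n; apply: dense_i; exact: recip_gt0.
  have Ax : A x.
    move=> e e0; have e4 : 0 < e / 4 by rewrite divr_gt0.
    have [N HN] := recip_small e4; have [N' HN'] := uc _ e4.
    exists (maxn N N') => m n; rewrite !geq_max => /andP[Nm N'm] /andP[Nn N'n].
    have -> : nr S (x m - x n) = nr S (q (c (x m)) - q (c (x n))).
      by rewrite qB// qp; [symmetry; apply: limsup_ev => [k|];
        [exact: nr_ge0|exists 0%N]|exact: AB].
    apply: le_trans (nr_trans S (u m) _ _) _; rewrite (nrC S _ (u m)).
    apply: le_trans (lerD (Hx m) (nr_trans S (u n) _ _)) _.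
    have := Hx n; have := HN _ Nm; have := HN _ Nn; have := HN' _ _ N'm N'n; lra.
  exists (q x) => e e0; have e2 : 0 < e / 2 by rewrite divr_gt0.
  have [N HN] := recip_small e2; have [N' HN'] := Ax _ e2.
  exists (maxn N N') => n; rewrite geq_max => /andP[Nn N'n].
  apply: le_trans (nr_trans S (q (c (x n))) _ _) _.
  have : nr S (q (c (x n)) - q x) <= e / 2.
    rewrite qB// qp; last exact: AB.
    apply: limsup_le => [m|]; first exact: nr_ge0.
    by exists N' => m N'm; apply: HN'.
  have := Hx n; have := HN _ Nn; lra.
exists X, (iso_comp S f (mk_iso ilin inr)) => x e e0.
have [v Hv] := dense_i (g x) e e0.
exists (f (q (c v))); first by exists v.
by rewrite -[x]gK -linearB iso_nr.
Qed.

End Completeness.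

(** * Chains and their limits *)

Section DependentProduct.
Variables (K : numFieldType) (V : nat -> lmodType K).

(** The product of the spaces of a chain; the elements of the union are
    represented in it by their images in all later spaces. *)
Definition seq_space : Type := forall n, V n.
HB.instance Definition _ := gen_eqMixin seq_space.
HB.instance Definition _ := gen_choiceMixin seq_space.

Let add (x y : seq_space) : seq_space := fun n => x n + y n.
Let opp (x : seq_space) : seq_space := fun n => - x n.
Let zero : seq_space := fun n => 0.
Let scale k (x : seq_space) : seq_space := fun n => k *: x n.

Let addA : associative add.
Proof. by move=> x y z; apply: functional_extensionality_dep => n; exact: addrA. Qed.
Let addC : commutative add.
Proof. by move=> x y; apply: functional_extensionality_dep => n; exact: addrC. Qed.
Let add0 : left_id zero add.
Proof. by move=> x; apply: functional_extensionality_dep => n; exact: add0r. Qed.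
Let addN : left_inverse zero opp add.
Proof. by move=> x; apply: functional_extensionality_dep => n; exact: addNr. Qed.
HB.instance Definition _ := GRing.isZmodule.Build seq_space addA addC add0 addN.

Let scaleA a b (x : seq_space) : scale a (scale b x) = scale (a * b) x.
Proof. by apply: functional_extensionality_dep => n; exact: scalerA. Qed.
Let scale1 : left_id 1 scale.
Proof. by move=> x; apply: functional_extensionality_dep => n; exact: scale1r. Qed.
Let scaleDr : right_distributive scale +%R.
Proof. by move=> a x y; apply: functional_extensionality_dep => n; exact: scalerDr. Qed.
Let scaleDl (x : seq_space) : {morph scale^~ x: a b / a + b}.
Proof. by move=> a b; apply: functional_extensionality_dep => n; exact: scalerDl. Qed.
HB.instance Definition _ := GRing.Zmodule_isLmodule.Build K seq_space
  scaleA scale1 scaleDr scaleDl.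

Lemma seq_spaceP k (x y : seq_space) n : (k *: x + y) n = k *: x n + y n.
Proof. by []. Qed.

End DependentProduct.

Section Transfer.
Variables (K : numFieldType) (E : chain K).

(** The image of x in E m for n <= m, and 0 for m < n.  Being total in m, it
    avoids a cast from E n to E (n + d), and it is itself an element of the
    product of the chain. *)
Fixpoint transfer n (x : E n) (m : nat) : E m :=
  match pselect (n = m) with
  | left e => eq_rect n (fun k => E k : Type) x m e
  | right _ => match m with
               | 0 => 0
               | m'.+1 => chain_incl E m' (transfer x m')
               end
  end.

Lemma transfer_id n (x : E n) : transfer x n = x.
Proof.
by case: n x => [|n] x /=; case: pselect => // e; rewrite (eq_irrelevance e erefl).
Qed.

Lemma transferS n (x : E n) m : (n <= m)%N ->
  transfer x m.+1 = chain_incl E m (transfer x m).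
Proof. by move=> nm /=; case: pselect => // e; exfalso; move: nm; rewrite e ltnn. Qed.

(** Induction on m starting at n, for statements in which m indexes a type. *)
Lemma transfer_ind n (P : forall m, Prop) : P n ->
  (forall m, (n <= m)%N -> P m -> P m.+1) -> forall m, (n <= m)%N -> P m.
Proof.
move=> Pn PS; elim=> [|m IH]; first by rewrite leqn0 => /eqP <-.
rewrite leq_eqVlt => /orP[/eqP <-//|]; rewrite ltnS => nm.
by apply: PS => //; apply: IH.
Qed.

Lemma transfer_linear n m : (n <= m)%N -> linear (fun x : E n => transfer x m).
Proof.
move: m; apply: transfer_ind => [k x y|m nm IH k x y]; first by rewrite !transfer_id.
by rewrite !transferS// IH linearP.
Qed.

Lemma transfer_norm n m (x : E n) : (n <= m)%N -> `|transfer x m| = `|x|.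
Proof.
move: m; apply: transfer_ind => [|m nm IH]; first by rewrite transfer_id.
by rewrite transferS// isoemb_norm.
Qed.

Lemma transfer_comp n l (x : E n) m : (n <= l)%N -> (l <= m)%N ->
  transfer (transfer x l) m = transfer x m.
Proof.
move=> nl; move: m; apply: transfer_ind => [|m lm IH]; first by rewrite transfer_id.
by rewrite !transferS ?IH// (leq_trans nl).
Qed.

Lemma transfer_incl n (x : E n) m : (n < m)%N ->
  transfer (chain_incl E n x) m = transfer x m.
Proof.
by move=> nm; rewrite -[x in chain_incl E n x]transfer_id -transferS// transfer_comp.
Qed.

Lemma coherent_transfer (T : Type) (j : forall n, E n -> T) :
  (forall n x, j n.+1 (chain_incl E n x) = j n x) ->
  forall n m (x : E n), (n <= m)%N -> j m (transfer x m) = j n x.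
Proof.
move=> jc n m x; move: m; apply: transfer_ind => [|m nm IH].
  by rewrite transfer_id.
by rewrite transferS// jc.
Qed.

End Transfer.

Arguments transfer : simpl never.

Section Limits.
Variables (R : realType) (K : numFieldType) (S : scalar_field R K).

Definition chain_range (E : chain K) (G : normedModType K)
    (j : forall n, isometric_embedding (E n) G) : set G :=
  [set y | exists n x, j n x = y].

(** G is a completion of the union of E.  This direct form, without the union
    itself, is the one in which chains are compared. *)
Definition chain_limit (E : chain K) (G : normedModType K) : Prop :=
  exists j : forall n, isometric_embedding (E n) G,
    (forall n x, j n.+1 (chain_incl E n x) = j n x) /\
    nr_dense S (chain_range j).

(** Threads that eventually follow the inclusions, modulo those that are
    eventually 0. *)
Lemma chain_union_ex (E : chain K) : exists U : normedModType K, is_chain_union E U.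
Proof.
pose A : set (seq_space (fun n => E n)) :=
  [set t | exists N, forall n, (N <= n)%N -> t n.+1 = chain_incl E n (t n)].
pose p (t : seq_space (fun n => E n)) := limsup (fun n => nr S (t n)).
have subA : subspace_set A.
  split=> [|k x y [N HN] [N' HN']].
    by exists 0%N => n _; rewrite linear0.
  exists (maxn N N') => n; rewrite geq_max => /andP[Nn N'n].
  by rewrite !seq_spaceP linearP HN ?HN'.
have Ab (t : seq_space (fun n => E n)) : A t -> ev_bounded (fun n => nr S (t n)).
  move=> [N HN]; exists (nr S (t N)), N; apply: transfer_ind => // n Nn IH.
  by rewrite HN// iso_nr.
have pA : is_seminorm_on S A p.
  split=> [x y Ax Ay|k x Ax].
    apply: limsupD => [n|||n]; [exact: nr_ge0|exact: Ab..|exact: nrD].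
  rewrite /p -limsupZ ?nr_ge0//; last 2 first.
  - by move=> n; exact: nr_ge0.
  - exact: Ab.
  by congr limsup; apply/funext => n; rewrite nrZ.
have [U [q [qlin qp qsurj]]] := normed_quotient subA pA.
pose th n (x : E n) : seq_space (fun n => E n) := transfer x.
have Ath n (x : E n) : A (th n x) by exists n => m; exact: transferS.
have p_ev (s t : seq_space (fun n => E n)) : A s -> A t ->
    (exists N, forall n, (N <= n)%N -> s n = t n) -> q s = q t.
  move=> As At [N HN].
  have AB : A ((-1) *: t + s) by exact: subA.2.
  apply/eqP; rewrite -subr_eq0; apply/eqP; apply: (@nr_eq0 _ _ S).
  rewrite addrC -scaleN1r -qlin// qp//; apply: limsup_ev => [n|].
    exact: nr_ge0.
  by exists N => n Nn; rewrite seq_spaceP HN// scaleN1r addNr nr0.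
have jlin n : linear (fun x : E n => q (th n x)).
  move=> k x y; rewrite -qlin//; apply: p_ev => //; first exact: subA.2.
  by exists n => m nm; rewrite seq_spaceP; exact: transfer_linear.
have jnr n x : nr S (q (th n x)) = nr S x.
  rewrite qp//; apply: limsup_ev => [m|]; first exact: nr_ge0.
  by exists n => m nm; apply/nr_norm; exact: transfer_norm.
exists U, (fun n => mk_iso (jlin n) (jnr n)); split=> [n x|u] /=.
  apply: p_ev => //; exists n.+1 => m; exact: transfer_incl.
have [t At <-] := qsurj u; have [N HN] := At.
exists N, (t N); apply: p_ev => //; exists N; apply: transfer_ind.
  exact: transfer_id.
by move=> m Nm e; rewrite HN// -e /th transferS.
Qed.

Lemma chain_limit_ex (E : chain K) : exists X : completeNormedModType K, chain_limit E X.
Proof.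
have [U [j [jc js]]] := chain_union_ex E.
have [X [i di]] := normed_completion S U.
exists X, (fun n => iso_comp S i (j n)); split=> [n x|x e e0] /=.
  by rewrite jc.
have [_ [u _ <-] xu] := di x e e0; have [n [y yu]] := js u.
by exists (i u) => //; exists n, y; rewrite /= yu.
Qed.

Section Comparison.
Variables (E : chain K) (X Y : completeNormedModType K).
Variables (jX : forall n, isometric_embedding (E n) X)
          (jY : forall n, isometric_embedding (E n) Y).
Hypothesis jXc : forall n x, jX n.+1 (chain_incl E n x) = jX n x.
Hypothesis jYc : forall n x, jY n.+1 (chain_incl E n x) = jY n x.

(** The graph of the isometry between two limits of the same chain: x and y
    are simultaneously approximated by the images of one vector.  This
    description is symmetric in X and Y, so that the isometry and its inverse
    come from the same lemmas. *)
Definition limit_rel (x : X) (y : Y) : Prop := forall e, 0 < e ->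
  exists n (u : E n), nr S (x - jX n u) <= e /\ nr S (y - jY n u) <= e.

Lemma limit_rel_ex x : nr_dense S (chain_range jX) ->
  exists y, limit_rel x y.
Proof.
move=> dX.
have /choice[nu Hu] : forall k, exists nu : {n & E n},
    nr S (x - jX _ (projT2 nu)) <= recip R k.
  move=> k; have [_ [n [u <-]] xu] := dX x _ (recip_gt0 R k).
  by exists (existT (fun n => E n : Type) n u); exact: xu.
pose a k := jY _ (projT2 (nu k)).
have aE k l : nr S (a k - a l) = nr S (jX _ (projT2 (nu k)) - jX _ (projT2 (nu l))).
  rewrite /a; case: (nu k) => n u; case: (nu l) => m v /=.
  pose M := maxn n m.
  rewrite -(coherent_transfer jYc u (leq_maxl n m)).
  rewrite -(coherent_transfer jYc v (leq_maxr n m)).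
  rewrite -(coherent_transfer jXc u (leq_maxl n m)).
  rewrite -(coherent_transfer jXc v (leq_maxr n m)).
  by rewrite -!linearB !iso_nr.
have ca : nr_cauchy S a.
  move=> e e0; have e2 : 0 < e / 2 by rewrite divr_gt0.
  have [N HN] := recip_small e2; exists N => m n Nm Nn; rewrite aE.
  apply: le_trans (nr_trans S x _ _) _; rewrite (nrC S _ x).
  have := Hu m; have := Hu n; have := HN _ Nm; have := HN _ Nn; lra.
have [y ay] := complete_nr_cvg ca.
exists y => e e0; have [N HN] := recip_small e0; have [N' HN'] := ay _ e0.
pose k := maxn N N'.
exists (projT1 (nu k)), (projT2 (nu k)); split.
  by apply: le_trans (Hu _) _; apply: HN; rewrite leq_maxl.
by rewrite nrC; apply: HN'; rewrite leq_maxr.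
Qed.

Lemma limit_relP k x x' y y' : limit_rel x y -> limit_rel x' y' ->
  limit_rel (k *: x + x') (k *: y + y').
Proof.
move=> xy xy' e e0.
have k1 : 0 < nr S k + 1 by rewrite ltr_wpDl ?nr_ge0.
have [|n [u [xu yu]]] := xy (e / 2 / (nr S k + 1)); first by rewrite !divr_gt0.
have [|m [v [xv yv]]] := xy' (e / 2); first by rewrite divr_gt0.
have nM := leq_maxl n m; have mM := leq_maxr n m.
exists (maxn n m), (k *: transfer u (maxn n m) + transfer v (maxn n m)).
rewrite !linearP /= !(coherent_transfer jXc _ nM, coherent_transfer jYc _ nM).
rewrite !(coherent_transfer jXc _ mM, coherent_transfer jYc _ mM).
rewrite (addrACA (k *: x)) (addrACA (k *: y)) -!scalerDr.
move: xu yu; rewrite !ler_pdivlMr// !mulrDr !mulr1 => xu yu.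
have := nr_ge0 S (x - jX n u); have := nr_ge0 S (y - jY n u) => ? ?.
split; apply: le_trans (nrD _ _ _) _; rewrite nrZ mulrC; lra.
Qed.

Lemma limit_rel_nr x y : limit_rel x y -> nr S x = nr S y.
Proof.
move=> xy; apply/le_anti/andP; split; apply/ler_addgt0Pr => e e0;
  have [|n [u [xu yu]]] := xy (e / 2); rewrite ?divr_gt0//.
  have := nr_le_dist S x (jX n u); have := nr_le_dist S (jY n u) y; rewrite (nrC S _ y) !iso_nr; lra.
have := nr_le_dist S y (jY n u); have := nr_le_dist S (jX n u) x; rewrite (nrC S _ x) !iso_nr; lra.
Qed.

Lemma limit_rel_fun x y y' : limit_rel x y -> limit_rel x y' -> y = y'.
Proof.
move=> xy xy'; apply/eqP; rewrite -subr_eq0; apply/eqP; apply: (@nr_eq0 _ _ S).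
rewrite addrC -scaleN1r -(limit_rel_nr (limit_relP (-1) xy' xy)).
by rewrite scaleN1r addNr nr0.
Qed.

End Comparison.

Lemma limit_rel_sym (E : chain K) (X Y : completeNormedModType K)
  (jX : forall n, isometric_embedding (E n) X)
  (jY : forall n, isometric_embedding (E n) Y) x y :
  limit_rel jX jY x y -> limit_rel jY jX y x.
Proof. by move=> xy e /xy[n [u [? ?]]]; exists n, u. Qed.

(** Uniqueness of the completion of the union. *)
Lemma chain_limit_unique (E : chain K) (X Y : completeNormedModType K) :
  chain_limit E X -> chain_limit E Y -> linearly_isometric X Y.
Proof.
move=> [jX [jXc jXd]] [jY [jYc jYd]].
have /choice[f xf] x := limit_rel_ex jXc jYc x jXd.
have /choice[g yg] y := limit_rel_ex jYc jXc y jYd.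
have flin : linear f.
  by move=> k x x'; apply: limit_rel_fun (xf _) _ => //; exact: limit_relP.
have fnr x : nr S (f x) = nr S x by rewrite (limit_rel_nr (xf x)).
exists (mk_iso flin fnr); exists g => [x|y] /=.
  by apply: limit_rel_fun (yg _) (limit_rel_sym (xf x)).
by apply: limit_rel_fun (xf _) (limit_rel_sym (yg y)).
Qed.

Lemma leads_toP (Sigma : odd_strategy K) (G : completeNormedModType K) :
  leads_to Sigma G <-> forall E, odd_uses Sigma E -> chain_limit E G.
Proof.
split=> [H E /H[U [X [[j [jc js]] [i di] [f [g fK gK]]]]]|H E /H EG].
  exists (fun n => iso_comp S f (iso_comp S i (j n))); split=> [n x|x e e0] /=.
    by rewrite jc.
  have [_ [u _ <-] xu] := (nr_denseP S _).1 di (g x) e e0.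
  have [n [y yu]] := js u.
  exists (f (i u)); first by exists n, y; rewrite /= yu.
  by rewrite -[x]gK -linearB iso_nr.
have [U [j [jc js]]] := chain_union_ex E.
have [X [i di]] := normed_completion S U.
exists U, X; split; [by exists j|by exists i; apply/(nr_denseP S)|].
apply: chain_limit_unique EG.
exists (fun n => iso_comp S i (j n)); split=> [n x|x e e0] /=.
  by rewrite jc.
have [_ [u _ <-] xu] := di x e e0; have [n [y yu]] := js u.
by exists (i u) => //; exists n, y; rewrite /= yu.
Qed.

End Limits.

(** * Plays, duels of strategies and the move of Odd *)

Section Play.
Variable K : numFieldType.

(** A rule dictates the moves of both players. *)
Definition rule := forall n (E : finDimNormedModType K), finite_chain n E -> extension E.

Section FromRule.
Variables (r : rule) (E0 : finDimNormedModType K).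

Fixpoint position n : {E : finDimNormedModType K & finite_chain n E} :=
  match n with
  | 0 => existT _ E0 (ChainStart E0)
  | m.+1 => let x := r (projT2 (position m)) in
            existT _ (ext_space x) (ChainStep (projT2 (position m)) (ext_incl x))
  end.

Definition rule_chain : chain K :=
  @Chain K (fun n => projT1 (position n)) (fun n => ext_incl (r (projT2 (position n)))).

Lemma rule_chain_prefix n : chain_prefix rule_chain n = projT2 (position n).
Proof. by elim: n => //= n ->. Qed.

Lemma rule_chain_ex : exists E : chain K,
  forall n, Extension (chain_incl E n) = r (chain_prefix E n).
Proof.
by exists rule_chain => n; rewrite rule_chain_prefix /=; case: (r _).
Qed.

End FromRule.

(** Drops the first space of a chain; a chain with a single space is left
    unchanged, which keeps the length n.-1 meaningful for n = 0. *)
Fixpoint finite_chain_behead n (E : finDimNormedModType K) (c : finite_chain n E) :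
    finite_chain n.-1 E :=
  match c in finite_chain n E return finite_chain n.-1 E with
  | ChainStart E => ChainStart E
  | ChainStep n E F c i =>
      match n return finite_chain n E -> finite_chain n F with
      | 0 => fun=> ChainStart F
      | m.+1 => fun c => ChainStep (finite_chain_behead c) i
      end c
  end.

Definition chain_behead (E : chain K) : chain K :=
  @Chain K (fun n => E n.+1) (fun n => chain_incl E n.+1).

Lemma chain_prefix_behead (E : chain K) n :
  chain_prefix (chain_behead E) n = finite_chain_behead (chain_prefix E n.+1).
Proof. by elim: n => //= n ->. Qed.

Definition trivial_extension (E : finDimNormedModType K) : extension E :=
  Extension (@IsometricEmbedding K E E (mk_linear (@id_linear K E)) (fun=> erefl)).

Definition cast_chain n m (E : finDimNormedModType K) (e : n = m)
  (c : finite_chain n E) : finite_chain m E := ecast m (finite_chain m E) e c.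

(** Even moves follow s on the whole chain, odd moves follow t on the beheaded
    chain.  The strategies are indexed by half the length, so the value of the
    rule is specified through casts along n = k.*2 and n = k.*2.+1; they
    disappear because equality proofs on nat are unique. *)
Lemma duel_rule (s t : odd_strategy K) : exists r : rule,
  forall (E : chain K), (forall n, Extension (chain_incl E n) = r n _ (chain_prefix E n)) ->
  odd_uses s E /\ odd_uses t (chain_behead E).
Proof.
have H n (E : finDimNormedModType K) (c : finite_chain n E) : exists x : extension E,
    (forall k (e : n = k.*2), x = s k E (cast_chain e c)) /\
    (forall k (e : n = k.*2.+1), x = t k E (finite_chain_behead (cast_chain e c))).
  have [/eqP o|/eqP o] := boolP (n == n./2.*2).
    exists (s n./2 E (cast_chain o c)); split=> [k e|k e]; last first.
      by exfalso; move: e o => ->; lia.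
    have ek : k = n./2 by move: e o => ->; lia.
    by subst k; rewrite (eq_irrelevance e o).
  have o' : n = n./2.*2.+1 by lia.
  exists (t n./2 E (finite_chain_behead (cast_chain o' c))); split=> k e.
    by exfalso; move: e o => ->; lia.
  have ek : k = n./2 by move: e o => ->; lia.
  by subst k; rewrite (eq_irrelevance e o').
exists (fun n E c => sval (cid (H n E c))) => E HE.
split=> k; last rewrite chain_prefix_behead.
  by rewrite HE; case: cid => x /= [Hx _]; rewrite (Hx k erefl).
by rewrite HE; case: cid => x /= [_ Hx]; rewrite (Hx k erefl).
Qed.

End Play.

Section Strategies.
Variables (R : realType) (K : numFieldType) (S : scalar_field R K).

Lemma zero_space_ex : exists Z : finDimNormedModType K, forall z : Z, z = 0.
Proof.
have ps : is_seminorm S (fun _ : 'rV[K]_0 => 0 : R).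
  by split=> [x y _ _|k x _]; rewrite ?addr0 ?mulr0.
have [Z [q [s [sK _]]]] := seminorm_separation ps.
by exists Z => z; rewrite -(sK z) (thinmx0 (s z)) linear0.
Qed.

Lemma chain_limit_behead (E : chain K) (G : normedModType K) :
  chain_limit S E G -> chain_limit S (chain_behead E) G.
Proof.
move=> [j [jc jd]]; exists (fun n => j n.+1); split=> [n x|y e e0].
  exact: jc.
have [_ [n [x <-]] yx] := jd y e e0; exists (j n x) => //.
by exists n, (chain_incl E n x); exact: jc.
Qed.

(** Both limits belong to the same play of s against t. *)
Lemma leads_to_unique (s t : odd_strategy K) (G H : completeNormedModType K) :
  leads_to s G -> leads_to t H -> linearly_isometric G H.
Proof.
move=> /(leads_toP S) sG /(leads_toP S) tH.
have [r Hr] := duel_rule s t; have [Z _] := zero_space_ex.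
have [E /Hr[/sG EG /tH EH]] := rule_chain_ex r Z.
by apply: chain_limit_unique EH; exact: chain_limit_behead.
Qed.

(** The range of f as a finite-dimensional normed space, with f factored
    through it. *)
Lemma linear_image (V : vectType K) (G : normedModType K) (f : {linear V -> G}) :
  exists (F : finDimNormedModType K) (q : {linear V -> F})
    (e : isometric_embedding F G), forall v, e (q v) = f v.
Proof.
have ps : is_seminorm S (fun v => nr S (f v)).
  by split=> [x y _ _|k x _]; rewrite ?linearD ?linearZ ?nrZ// nrD.
have [F [q [s [sK qp]]]] := seminorm_separation ps.
have enr w : nr S (f (s w)) = nr S w by rewrite -qp sK.
exists F, q, (mk_iso (comp_linear s f) enr) => v /=.
apply/eqP; rewrite -subr_eq0; apply/eqP; apply: (@nr_eq0 _ _ S).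
by rewrite -linearB -qp linearB sK subrr nr0.
Qed.

Section Gurarii.
Variable G : normedModType K.
Hypothesis GG : gurarii_property G.

Lemma gurarii_nr (d : R) : 0 < d ->
  forall (A B : finDimNormedModType K) (i : isometric_embedding A B)
         (e : isometric_embedding A G),
  exists2 f : {linear B -> G}, forall a, f (i a) = e a & near_isometry S d f.
Proof.
move=> d0 A B i e; have Sd : 0 < S d by rewrite -(rmorph0 S) emb_lt.
by have [f fe /near_isometryP fd] := GG Sd i e; exists f.
Qed.

(** What Odd achieves in one round: a map on the new space of Eve that is close
    to the previous map g on the old space and has y 0, ..., y (m - 1) in its
    range. *)
Definition good_step (D F : finDimNormedModType K) (u : D -> F) (g : D -> G)
    (d d' : R) (m : nat) (y : nat -> G) (g' : F -> G) :=
  [/\ near_isometry S d' g', forall x, nr S (g' (u x) - g x) <= (1 + d') * d * nr S x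
    & forall l, (l < m)%N -> exists x, g' x = y l].

(** Odd amalgamates D with the subspace F of G spanned by the range of g and
    the y l, along g.  The next map g' extends the inclusion of F, so on D it
    differs from g by the image of x - g x, a vector of norm at most d |x|. *)
Lemma odd_move (D : finDimNormedModType K) (g : {linear D -> G})
    (d d' : R) (m : nat) (y : nat -> G) : 0 <= d -> 0 < d' ->
  near_isometry S d g -> exists x : extension D,
  forall (F : finDimNormedModType K) (i : isometric_embedding (ext_space x) F),
  exists g' : {linear F -> G}, good_step (i \o ext_incl x) g d d' m y g'.
Proof.
move=> d0 d'0 gd.
have flin : linear (fun v : (D * 'rV[K]_m)%type => g v.1 + \sum_l v.2 0 l *: y l).
  move=> k [x a] [x' b] /=; rewrite linearP scalerDr addrACA scaler_sumr -big_split /=.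
  by congr (_ + _); apply: eq_bigr => l _; rewrite !mxE scalerDl scalerA.
have [F [q [e eq]]] := linear_image (mk_linear flin).
have clin : linear (fun x : D => q (x, 0)).
  by move=> k x x'; rewrite -linearP; congr (q (_, _)); rewrite /= scaler0 addr0.
have ec x : e (q (x, 0)) = g x.
  by rewrite eq /= big1 ?addr0// => l _; rewrite mxE scale0r.
have cd : near_isometry S d (mk_linear clin).
  by move=> x /=; rewrite -(iso_nr S e) ec; exact: gd.
have [W [b [c Hbc]]] := amalgamation (iso_id S D) d0 cd.
exists (Extension b) => F' i /=.
have [g' g'e g'd] := gurarii_nr d'0 (iso_comp S i c) e.
exists g'; split=> [//|x|l lm].
  have -> : g' ((i \o b) x) - g x = g' (i (b x - c (q (x, 0)))).
    by rewrite !linearB /= -ec -g'e.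
  have /andP[_ /le_trans] := g'd (i (b x - c (q (x, 0)))); apply.
  rewrite iso_nr -mulrA; apply: ler_wpM2l; first by rewrite addr_ge0// ltW.
  exact: Hbc.
exists (i (c (q (0, delta_mx 0 (Ordinal lm))))).
rewrite [LHS]g'e eq /= linear0 add0r (bigD1 (Ordinal lm))//= mxE !eqxx scale1r.
by rewrite big1 ?addr0// => k /negPf kl; rewrite mxE kl andbF scale0r.
Qed.

End Gurarii.
End Strategies.

(** * A strategy of Odd leading to a given Gurarii space *)

Section Tracking.
Variables (R : realType) (K : numFieldType) (S : scalar_field R K).
Variables (G : completeNormedModType K) (y : nat -> G).
Hypothesis GG : gurarii_property G.

(** The admissible error after k rounds.  It is summable, for the tracking maps
    to converge, and at most 1 / 2, for them to be bounded below. *)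
Definition tol (k : nat) : R := 2^-1 ^+ k.+1.

Lemma tol_gt0 k : 0 < tol k. Proof. by rewrite /tol exprn_gt0 ?invr_gt0 ?ltr0n. Qed.
Lemma tolS k : tol k = 2 * tol k.+1.
Proof. by rewrite /tol [in RHS]exprS mulrA mulfV ?mul1r ?pnatr_eq0. Qed.
Lemma tol_le1 k : tol k <= 2^-1.
Proof.
elim: k => [|k IH]; first by rewrite /tol expr1.
by apply: le_trans IH; have := tol_gt0 k.+1; rewrite (tolS k); lra.
Qed.
Lemma tol_small e : 0 < e -> exists N, forall n, (N <= n)%N -> tol n <= e.
Proof.
move=> e0; have [N HN] := recip_small e0; exists N => n Nn.
apply: le_trans (HN n Nn); rewrite /tol /recip exprVn lef_pV2 ?posrE ?exprn_gt0//.
by rewrite -natrX ler_nat ltnW// ltn_expl.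
Qed.

(** What is remembered of a play: the last space of Eve, its inclusion in the
    current space, and the map from it to G. *)
Record tracker (E : finDimNormedModType K) := Tracker {
  tr_space : finDimNormedModType K;
  tr_incl : {linear tr_space -> E};
  tr_map : {linear tr_space -> G} }.

(** [n] is the index of the current space E, either that of the last space of
    Eve, and then i makes two moves, or the next one, and then i makes one: the
    number of the round is n./2 in both cases. *)
Definition tracks (n : nat) (E F : finDimNormedModType K) (t : tracker E)
    (i : E -> F) (g : {linear F -> G}) :=
  good_step S (fun x => i (tr_incl t x)) (tr_map t) (tol n./2) (tol n./2.+1) n./2.+1 y g.

Definition pick_or (T : Type) (d : T) (P : T -> Prop) : T :=
  match pselect (exists x, P x) with
  | left h => sval (cid h)
  | right _ => d
  end.

Lemma pick_orP (T : Type) (d : T) (P : T -> Prop) : (exists x, P x) -> P (pick_or d P).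
Proof. by rewrite /pick_or; case: pselect => // h _; case: cid. Qed.

Definition zero_map (E : finDimNormedModType K) : {linear E -> G} := \0.
Definition pick_map (E : finDimNormedModType K) (P : set {linear E -> G}) :=
  pick_or (zero_map E) P.

(** The moves of Odd, at even n, leave the map unchanged; after a move of Eve,
    at odd n, a new map is chosen.  As a strategy only sees the chain, the
    maps are recomputed from it, and [pick_map] makes this a function. *)
Fixpoint track n (E : finDimNormedModType K) (c : finite_chain n E) : tracker E :=
  match c in finite_chain n E return tracker E with
  | ChainStart E =>
      Tracker (mk_linear (@id_linear K E)) (pick_map [set g | near_isometry S (tol 0) g])
  | ChainStep n E F c i =>
      let t := track c in
      if odd n
      then Tracker (mk_linear (@id_linear K F)) (pick_map [set g | tracks n t i g])
      else Tracker (lcomp i (tr_incl t)) (tr_map t)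
  end.

Definition gurarii_strategy : odd_strategy K := fun k E c =>
  pick_or (trivial_extension E) (fun x =>
    forall (F : finDimNormedModType K) (i : isometric_embedding (ext_space x) F),
    exists g', tracks k.*2 (track c) (i \o ext_incl x) g').

Lemma pick_mapP (E : finDimNormedModType K) (P : set {linear E -> G}) :
  (exists g, P g) -> P (pick_map P).
Proof. exact: pick_orP. Qed.

Section Run.
Variable E : chain K.
Hypothesis EO : odd_uses gurarii_strategy E.

Definition track_state k (g : {linear E k.*2 -> G}) :=
  track (chain_prefix E k.*2) = Tracker (mk_linear (@id_linear K (E k.*2))) g /\
  near_isometry S (tol k) g.

Definition two_steps k : E k.*2 -> E k.+1.*2 :=
  chain_incl E k.*2.+1 \o chain_incl E k.*2.

(** The zero space embeds in the first space of Eve and in G; the Gurarii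
    property extends this trivial embedding. *)
Lemma track_state0 : exists g, @track_state 0 g.
Proof.
eexists; split; first by [].
apply: (@pick_mapP (E 0) [set g : {linear E 0 -> G} | near_isometry S (tol 0) g]).
have [Z Z0] := zero_space_ex S.
have zlin (V : normedModType K) : linear (fun _ : Z => 0 : V).
  by move=> k x x'; rewrite scaler0 addr0.
have znr (V : normedModType K) (z : Z) : nr S (0 : V) = nr S z.
  by rewrite (Z0 z) !nr0.
have [g _ gd] := gurarii_nr S GG (tol_gt0 0) (mk_iso (zlin (E 0)) (znr (E 0)))
  (mk_iso (zlin G) (znr G)).
by exists g.
Qed.

Lemma track_stateS k g : @track_state k g -> exists g', @track_state k.+1 g' /\
  good_step S (@two_steps k) g (tol k) (tol k.+1) k.+1 y g'.
Proof.
move=> [tE gd].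
have [x Hx] := odd_move GG k.+1 y (ltW (tol_gt0 k)) (tol_gt0 k.+1) gd.
have := EO k; rewrite /gurarii_strategy tE; set P := (X in pick_or _ X) => EOk.
have : P (Extension (chain_incl E k.*2)).
  rewrite EOk; apply: pick_orP; exists x => F i.
  by have [g' Hg'] := Hx F i; exists g'; rewrite /tracks doubleK.
move=> /(_ _ (chain_incl E k.*2.+1)) /= [g' Hg'].
rewrite /track_state /= odd_double /=; set Q := (X in pick_map X).
have QE f : Q f <-> good_step S (@two_steps k) g (tol k) (tol k.+1) k.+1 y f.
  by rewrite /Q /tracks /= tE /= uphalf_double.
have : Q (pick_map Q).
  by apply: pick_mapP; exists g'; apply/QE; move: Hg'; rewrite /tracks /= doubleK.
by move=> /QE gs; exists (pick_map Q); split=> //; split=> //; case: gs.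
Qed.

Lemma track_maps : exists g : forall k, {linear E k.*2 -> G}, forall k,
  near_isometry S (tol k) (g k) /\
  good_step S (@two_steps k) (g k) (tol k) (tol k.+1) k.+1 y (g k.+1).
Proof.
pose T k := {g | @track_state k g}.
have t0 : T 0 by have /cid[g ?] := track_state0; exists g.
have tS k (t : T k) : {t' : T k.+1 |
    good_step S (@two_steps k) (sval t) (tol k) (tol k.+1) k.+1 y (sval t')}.
  by case: t => g gs; have /cid[g' [sg' ?]] := track_stateS gs; exists (exist _ g' sg').
pose t := nat_rect T t0 (fun k t => sval (tS k t)).
exists (fun k => sval (t k)) => k; split; first by case: (t k) => g [].
exact: svalP (tS k (t k)).
Qed.

Lemma geometric_cvg (a : nat -> G) c k0 : 0 <= c ->
    (forall k, (k0 <= k)%N -> nr S (a k.+1 - a k) <= 2 * tol k * c) ->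
  exists l, forall k, (k0 <= k)%N -> nr S (l - a k) <= 4 * tol k * c.
Proof.
move=> c0 Ha.
have Hkd k d : (k0 <= k)%N -> nr S (a (k + d)%N - a k) <= 4 * (tol k - tol (k + d)) * c.
  move=> kk; elim: d => [|d IH]; first by rewrite addn0 !subrr nr0 mulr0 mul0r.
  rewrite addnS; apply: le_trans (nr_trans S (a (k + d)%N) _ _) _.
  have := Ha (k + d)%N (leq_trans kk (leq_addr _ _)).
  move: IH; rewrite (tolS (k + d)); lra.
have Hkl k l : (k0 <= k)%N -> (k <= l)%N -> nr S (a l - a k) <= 4 * tol k * c.
  move=> kk kl; rewrite -(subnKC kl); apply: le_trans (Hkd _ _ kk) _.
  by apply: ler_wpM2r => //; have := tol_gt0 (k + (l - k)); lra.
have ca : nr_cauchy S a.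
  move=> e e0; have c1 : 0 < 8 * (c + 1) by lra.
  have [|N HN] := tol_small (e := e / (8 * (c + 1))); first by rewrite divr_gt0.
  exists (maxn N k0) => m n; rewrite !geq_max => /andP[Nm km] /andP[Nn kn].
  apply: le_trans (nr_trans S (a (maxn N k0)) _ _) _; rewrite (nrC S (a _) (a n)).
  have kM : (k0 <= maxn N k0)%N by rewrite leq_maxr.
  have := Hkl _ m kM; have := Hkl _ n kM; rewrite !geq_max Nm Nn km kn => /(_ isT) H1 /(_ isT) H2.
  have := HN _ (leq_maxl N k0); rewrite ler_pdivlMr// => H.
  have := tol_gt0 (maxn N k0); lra.
have [l al] := complete_nr_cvg ca; exists l => k kk.
apply/ler_addgt0Pr => e e0; have [N HN] := al e e0.
apply: le_trans (nr_trans S (a (maxn N k)) _ _) _.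
have := HN (maxn N k) (leq_maxl _ _); rewrite nrC => H1.
have := Hkl k (maxn N k) kk (leq_maxr _ _); lra.
Qed.

Lemma le0_tol (r c : R) k0 : (forall k, (k0 <= k)%N -> r <= tol k * c) -> r <= 0.
Proof.
move=> H; apply/ler_addgt0Pr => e e0; rewrite add0r.
have c1 : 0 < `|c| + 1 by rewrite ltr_wpDl.
have [|N HN] := tol_small (e := e / (`|c| + 1)); first by rewrite divr_gt0.
apply: le_trans (H (maxn k0 N) (leq_maxl _ _)) _.
have := HN _ (leq_maxr k0 N); rewrite ler_pdivlMr//.
apply: le_trans; apply: ler_wpM2l; first exact/ltW/tol_gt0.
by apply: le_trans (ler_norm c) _; lra.
Qed.

(** The limit of the tracking maps.  Density: y l is the value of g (k + 1) at
    some x for all large k, the limit map differs from g (k + 1) at x by at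
    most 4 tol (k + 1) |x|, and |x| <= 2 |y l|. *)
Lemma strategy_chain_limit :
  (forall z e, 0 < e -> exists l, nr S (z - y l) <= e) -> chain_limit S E G.
Proof.
move=> yd; have [g Hg] := track_maps.
have gd k x : nr S (g k x) <= (1 + tol k) * nr S x /\ (1 - tol k) * nr S x <= nr S (g k x).
  by have [/(_ x)/andP[]] := Hg k.
pose good n (x : E n) (z : G) := forall k, (n <= k.*2)%N ->
  nr S (z - g k (transfer x k.*2)) <= 4 * tol k * nr S x.
have tr_nr n (x : E n) m : (n <= m)%N -> nr S (transfer x m) = nr S x.
  by move=> nm; apply/nr_norm; exact: transfer_norm.
have good_ex n (x : E n) : exists z, good n x z.
  pose a k := g k (transfer x k.*2).
  have [|z Hz] := geometric_cvg (a := a) (k0 := uphalf n) (nr_ge0 S x).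
    move=> k kn; have nk : (n <= k.*2)%N by lia.
    have [_ [_ /(_ (transfer x k.*2)) H _]] := Hg k.
    rewrite /a.
    have -> : transfer x k.+1.*2 = @two_steps k (transfer x k.*2).
      rewrite [LHS](@transferS _ _ _ x k.*2.+1); last by lia.
      by rewrite (@transferS _ _ _ x k.*2).
    apply: le_trans H _; rewrite tr_nr//; apply: ler_wpM2r; first exact: nr_ge0.
    apply: ler_wpM2r; first exact/ltW/tol_gt0.
    by have := tol_le1 k.+1; lra.
  by exists z => k nk; apply: Hz; lia.
pose j n (x : E n) := sval (cid (good_ex n x)).
have jP n (x : E n) : good n x (j n x) by rewrite /j; case: cid.
have jlin n : linear (j n).
  move=> c x x'; apply/eqP; rewrite -subr_eq0; apply/eqP; apply: (@nr_eq0 _ _ S).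
  apply/le_anti; rewrite nr_ge0 andbT.
  apply: (@le0_tol _ (4 * nr S (c *: x + x') + nr S c * 4 * nr S x + 4 * nr S x') n) => k nk.
  have nk2 : (n <= k.*2)%N by lia.
  have H1 := jP n (c *: x + x') k nk2; have H2 := jP n x k nk2; have H3 := jP n x' k nk2.
  move: H1; rewrite (transfer_linear nk2) linearP.
  set u := g k (transfer x _) in H2 *; set u' := g k (transfer x' _) in H3 *.
  set w := j n (c *: x + x') => H1.
  have -> : w - (c *: j n x + j n x') = (w - (c *: u + u')) - (c *: (j n x - u) + (j n x' - u')).
    by rewrite scalerBr [c *: j n x - _ + _]addrACA -[- (c *: u) - u']opprD opprB subrKA.
  apply: le_trans (nrD _ _ _) _; rewrite nrN.
  apply: le_trans (lerD (lexx _) (nrD _ _ _)) _; rewrite nrZ.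
  have := ler_wpM2l (nr_ge0 S c) H2; lra.
have jnr n x : nr S (j n x) = nr S x.
  apply/le_anti/andP; split; rewrite -subr_le0.
    apply: (@le0_tol _ (5 * nr S x) n) => k nk.
    have nk2 : (n <= k.*2)%N by lia.
    have := jP n x k nk2; have [H _] := gd k (transfer x k.*2); move: H; rewrite tr_nr//.
    have := nr_le_dist S (j n x) (g k (transfer x k.*2)); lra.
  apply: (@le0_tol _ (5 * nr S x) n) => k nk.
  have nk2 : (n <= k.*2)%N by lia.
  have := jP n x k nk2; have [_ H] := gd k (transfer x k.*2); move: H; rewrite tr_nr//.
  have := nr_le_dist S (g k (transfer x k.*2)) (j n x); rewrite (nrC S _ (j n x)); lra.
exists (fun n => mk_iso (jlin n) (jnr n)); split=> [n x|z e e0] /=.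
  apply/eqP; rewrite -subr_eq0; apply/eqP; apply: (@nr_eq0 _ _ S).
  apply/le_anti; rewrite nr_ge0 andbT.
  apply: (@le0_tol _ (8 * nr S x) n.+1) => k nk.
  have H1 := jP n x k (ltac:(lia)); have := jP n.+1 (chain_incl E n x) k (ltac:(lia)).
  rewrite transfer_incl; last by lia.
  rewrite iso_nr => H2; apply: le_trans (nr_trans S (g k (transfer x k.*2)) _ _) _.
  rewrite (nrC S (g k _)); lra.
have [|l Hl] := yd z (e / 2); first by rewrite divr_gt0.
have c1 : 0 < 16 * (nr S (y l) + 1) by have := nr_ge0 S (y l); lra.
have [|N HN] := tol_small (e := e / (16 * (nr S (y l) + 1))); first by rewrite divr_gt0.
pose k := maxn l N.
have [_ [_ _ /(_ l)[|x xl]]] := Hg k; first by rewrite ltnS leq_maxl.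
exists (j k.+1.*2 x); first by exists k.+1.*2, x.
have := jP k.+1.*2 x k.+1 (leqnn _); rewrite transfer_id xl => H1.
apply: le_trans (nr_trans S (y l) _ _) _; rewrite (nrC S (y l)).
suff : 4 * tol k.+1 * nr S x <= e / 2 by lra.
have [_] := gd k.+1 x; rewrite xl => H2.
have := HN k (leq_maxr _ _); rewrite ler_pdivlMr// => H3.
have H4 : nr S x <= 2 * nr S (y l).
  have := ler_wpM2r (nr_ge0 S x) (tol_le1 k.+1); lra.
have := tol_gt0 k.+1 => t0.
have := ler_wpM2l (ltW t0) H4; move: H3; rewrite (tolS k); lra.
Qed.

End Run.
End Tracking.

Lemma separable_seq (R : realType) (K : numFieldType) (S : scalar_field R K)
    (G : normedModType K) : separable G ->
  exists y : nat -> G, forall z e, 0 < e -> exists l, nr S (z - y l) <= e.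
Proof.
move=> [D /countable_injP[f finj] /(nr_denseP S) dD].
exists (fun l => xget 0 [set z | D z /\ f z = l]) => z e e0.
have [w Dw zw] := dD z e e0; exists (f w).
case: xgetP => [_ -> [Dv fv]|/(_ w)[]//].
by rewrite (finj _ _ _ _ fv) ?inE.
Qed.

Lemma gurarii_strategy_leads_to (R : realType) (K : numFieldType)
    (S : scalar_field R K) (G : completeNormedModType K) :
  separable G -> gurarii_property G -> exists s : odd_strategy K, leads_to s G.
Proof.
move=> /(separable_seq S)[y yd] GG; exists (gurarii_strategy S y).
by apply/(leads_toP S) => E EO; exact: strategy_chain_limit EO yd.
Qed.

(** * Local compactness of the scalars and coordinates *)

Section Instances.
Variable R : realType.

Lemma real_unit_ball : exists2 B : set R, compact B & forall k : R, `|k| <= 1 -> B k.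
Proof.
exists [set` `[-1, 1]]; first exact: segment_compact.
by move=> k; rewrite ler_norml /= in_itv.
Qed.

Definition real_scalar_field : scalar_field R R :=
  @ScalarField R R idfun id (fun=> fun=> erefl) (fun=> fun=> erefl) real_unit_ball.

Let C : numFieldType := R[i].

(** The square with sides [-1, 1] is compact and contains the unit disc. *)
Lemma complex_unit_ball :
  exists2 B : set C, compact B & forall k : C, `|k| <= 1 -> B k.
Proof.
pose f (u : R * R) : C := u.1%:C%C + 'i%C * u.2%:C%C.
have emb_cts : continuous (fun a : R => a%:C%C : C).
  move=> a A /nbhs_ballP[e /= e0 He].
  have [b eb] : exists b, e = b%:C%C.
    by apply/complex_realP; rewrite realE ltW.
  have b0 : 0 < b by move: e0; rewrite eb ltcR.
  apply/nbhs_ballP; exists b => //= c; rewrite -ball_normE /= => ac.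
  apply: He; rewrite -ball_normE /= eb -rmorphB normc_def /= expr0n addr0 sqrtr_sqr.
  by rewrite ltcR.
exists (f @` ([set` `[-1, 1]] `*` [set` `[-1, 1]])).
  apply: continuous_compact; last by apply: compact_setX; exact: segment_compact.
  apply: continuous_subspaceT => u; apply: cvgD.
    by apply: continuous_comp; [exact: cvg_fst|exact: emb_cts].
  apply: cvgM; first exact: cvg_cst.
  by apply: continuous_comp; [exact: cvg_snd|exact: emb_cts].
move=> [a b] ab; exists (a, b); last by rewrite /f /= [RHS]complexE.
have {ab} : `|(a +i* b)%C : R[i]| <= 1%:C%C := ab.
rewrite normc_def lecR /= -[leRHS]sqrtr1 ler_psqrt ?nnegrE ?addr_ge0 ?sqr_ge0// => ab.
have := sqr_ge0 a; have := sqr_ge0 b => a0 b0.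
split; rewrite /= in_itv /= -ler_norml -(@ler_pXn2r _ 2) ?nnegrE// expr1n real_normK ?num_real//; lra.
Qed.

Definition complex_scalar_field : scalar_field R R[i].
Proof.
apply: (@ScalarField R R[i] (real_complex R) (@complex.Re R)).
- by move=> a b; exact: lecR.
- by move=> k k0; exact: (RRe_real (ger0_real k0)).
- exact: complex_unit_ball.
Defined.

End Instances.

Lemma real_or_complex_scalar_field (R : realType) (K : numFieldType) :
  real_or_complex R K -> exists S : scalar_field R K, True.
Proof.
by case; [exists (real_scalar_field R)|exists (complex_scalar_field R)].
Qed.

Section Coordinates.
Variables (R : realType) (K : numFieldType) (S : scalar_field R K).

(** Otherwise a sequence of A along which the norm tends to 0 has a cluster
    point in A, where the norm vanishes by continuity. *)
Lemma compact_nr_lower_bound n (A : set 'rV[K]_n) (V : normedModType K)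
    (b : 'I_n -> V) : compact A ->
    (forall v, A v -> \sum_i v 0 i *: b i != 0) ->
  exists2 c : R, 0 < c & forall v, A v -> c <= nr S (\sum_i v 0 i *: b i).
Proof.
move=> cA A0; pose N (v : 'rV[K]_n) := nr S (\sum_i v 0 i *: b i).
apply: contrapT => nc.
have /choice[v Hv] : forall k, exists v, A v /\ N v <= recip R k.
  move=> k; apply: contrapT => nv; apply: nc; exists (recip R k); first exact: recip_gt0.
  move=> v Av; rewrite leNgt; apply/negP => vk; apply: nv; exists v; split=> //.
  exact: ltW.
have FA : (v @ \oo) A by exists 0%N => // k _; exact: (Hv k).1.
have [w [Aw cw]] := cA (v @ \oo) _ FA.
have Nw : 0 < N w.
  rewrite lt_neqAle nr_ge0 andbT eq_sym; apply/eqP => /nr_eq0 e.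
  by move/eqP: (A0 _ Aw).
pose M := \sum_i nr S (b i); have M0 : 0 <= M by apply: sumr_ge0 => i _; exact: nr_ge0.
have d0 : 0 < N w / 4 / (M + 1) by rewrite !divr_gt0// ltr_wpDl.
have Sd0 : 0 < S (N w / 4 / (M + 1)) by rewrite -(rmorph0 S) emb_lt.
have [|N0 HN] := @recip_small R (N w / 4); first by rewrite divr_gt0.
have Fv : (v @ \oo) [set u | N u <= N w / 4].
  by exists N0 => // k /= Nk; apply: le_trans (Hv k).2 _; exact: HN.
have [u [/= Nu [_ uw]]] := cw _ _ Fv (nbhsx_ballx w _ Sd0).
have : N (w - u) <= N w / 4 / (M + 1) * M.
  apply: le_trans (nr_sum _ _ _ _) _; rewrite mulr_sumr; apply: ler_sum => i _.
  rewrite nrZ !mxE; apply: ler_wpM2r; first exact: nr_ge0.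
  by have /ball_nr/ltW := uw 0 i.
rewrite mulrAC ler_pdivlMr ?ltr_wpDl// => H.
have : N w <= N u + N (w - u).
  apply: le_trans (nr_le_dist _ _ (\sum_i u 0 i *: b i)) _; rewrite lerD2l -sumrB.
  by rewrite /N (eq_bigr (fun i => (w - u) 0 i *: b i))// => i _; rewrite -scalerBl !mxE.
move: Nu Nw H; rewrite /=; set t := N (w - u); nra.
Qed.


Section CoordNorm.
Variable V : vectType K.
Local Notation b := (vbasis {:V}).

(** The l^1 norm of the coordinates in the canonical basis.  It compares
    seminorms on spaces that carry no norm. *)
Definition coord_norm (v : V) : R := \sum_i nr S (coord b i v).

Lemma coord_normP : is_seminorm S coord_norm.
Proof.
split=> [x y _ _|k x _].
  rewrite -big_split; apply: ler_sum => i _; rewrite linearD; exact: nrD.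
by rewrite /coord_norm mulr_sumr; apply: eq_bigr => i _; rewrite linearZ nrM.
Qed.

Lemma coord_sum v : v = \sum_i coord b i v *: b`_i.
Proof. by apply: coord_vbasis; rewrite memvf. Qed.

Lemma seminorm_le_coord_norm (p : V -> R) : is_seminorm S p ->
  exists2 C, 0 <= C & forall v, p v <= C * coord_norm v.
Proof.
move=> ps; exists (\sum_(i < \dim {:V}) p b`_i).
  by apply: sumr_ge0 => i _; exact: sn_ge0 ps _.
move=> v; rewrite {1}(coord_sum v) mulrC.
apply: le_trans (sn_sum ps _ _) _; rewrite mulr_sumr; apply: ler_sum => i _.
rewrite (snZ ps); apply: ler_wpM2r; first exact: sn_ge0 ps _.
by rewrite /coord_norm (bigD1 i)//= lerDl; apply: sumr_ge0 => j _; exact: nr_ge0.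
Qed.

End CoordNorm.

Lemma nr_seminorm (V : normedModType K) : is_seminorm S (nr S (V := V)).
Proof. by split=> *; [exact: nrD|exact: nrZ]. Qed.

Lemma unit_coord_compact n (i : 'I_n) (B : set K) : compact B ->
  compact [set v : 'rV[K]_n | forall j, (if j == i then [set 1] else B) (v 0 j)].
Proof.
move=> cB; apply: (@rV_compact K n (fun j => if j == i then [set (1 : K)] else B)) => j.
by case: ifP => // _; exact: compact_set1.
Qed.

(** Equivalence of norms.  Scaling x so that its largest coordinate, the k-th
    say, is 1 brings the coordinates into a compact set which does not contain
    the origin; the norm is bounded below there. *)
Lemma coord_norm_bounded (W : finDimNormedModType K) :
  exists2 C, 0 <= C & forall x : W, coord_norm x <= C * nr S x.
Proof.
have [B cB HB] := unit_ball_precompact S.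
pose n := \dim {:W}; pose b := vbasis {:W}.
(* Vectors with i-th coordinate 1 and the others in a compact set containing the unit ball. *)
pose A (i : 'I_n) := [set v : 'rV[K]_n | forall j, (if j == i then [set 1] else B) (v 0 j)].
have A0 i v : A i v -> \sum_j v 0 j *: b`_j != 0.
  move=> /(_ i); rewrite eqxx /= => vi; apply/negP => /eqP e.
  have /freeP/(_ (fun j => v 0 j) e i) : free b by apply: basis_free; exact: vbasisP.
  by rewrite vi => /eqP; rewrite oner_eq0.
have /choice[c Hc] i : exists c, 0 < c /\
    forall v, A i v -> c <= nr S (\sum_j v 0 j *: b`_j).
  have [c c0 Hc] := compact_nr_lower_bound (unit_coord_compact cB (i := i)) (A0 i).
  by exists c.
have ci i : 0 <= (c i)^-1 by rewrite invr_ge0 ltW// (Hc i).1.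
exists (n%:R * \sum_i (c i)^-1); first by rewrite mulr_ge0// sumr_ge0.
move=> x; rewrite -mulrA /coord_norm.
suff H i : nr S (coord b i x) <= (\sum_i (c i)^-1) * nr S x.
  apply: le_trans (ler_sum _ (fun i _ => H i)) _.
  by rewrite sumr_const card_ord mulr_natl.
have [k _ kmax] := @Order.TotalTheory.arg_maxP _ _ _ i xpredT (fun j => nr S (coord b j x)) isT.
apply: le_trans (kmax i isT) _ => /=.
have [->|k0] := eqVneq (nr S (coord b k x)) 0.
  by rewrite mulr_ge0 ?nr_ge0// sumr_ge0.
have kp : 0 < nr S (coord b k x) by rewrite lt_neqAle eq_sym k0 nr_ge0.
have kn : coord b k x != 0 by apply: contra_neq k0 => ->; rewrite nr0.
pose v : 'rV[K]_n := \row_j ((coord b k x)^-1 * coord b j x).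
have nrV : nr S (coord b k x)^-1 = (nr S (coord b k x))^-1.
  by apply: (mulIf k0); rewrite mulVf// -nrM mulVf// nr1.
have Av : A k v.
  move=> j /=; rewrite mxE; case: eqP => [->|_] /=; first by rewrite mulVf.
  apply: HB; rewrite -(emb_nr S) -(rmorph1 S) emb_le nrM nrV ler_pdivrMl// mulr1.
  exact: kmax.
have := (Hc k).2 v Av.
rewrite (eq_bigr (fun j => (coord b k x)^-1 *: (coord b j x *: b`_j))); last first.
  by move=> j _; rewrite mxE scalerA.
rewrite -scaler_sumr -coord_sum nrZ nrV ler_pdivlMl// => H.
apply: (@le_trans _ _ ((c k)^-1 * nr S x)).
  by rewrite ler_pdivlMl ?(Hc k).1// mulrC.
apply: ler_wpM2r; first exact: nr_ge0.
by rewrite (bigD1 k)//= lerDl; apply: sumr_ge0.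
Qed.

Lemma seminorm_bounded (W : finDimNormedModType K) (p : W -> R) : is_seminorm S p ->
  exists2 C, 0 <= C & forall x, p x <= C * nr S x.
Proof.
move=> ps; have [C C0 HC] := seminorm_le_coord_norm ps.
have [D D0 HD] := coord_norm_bounded W; exists (C * D); first exact: mulr_ge0.
by move=> x; apply: le_trans (HC x) _; rewrite -mulrA ler_wpM2l.
Qed.

(** Total boundedness of the unit ball of the scalars. *)
Lemma scalar_net d : 0 < d -> exists s : seq K,
  forall k, nr S k <= 1 -> exists2 u, u \in s & nr S (k - u) <= d.
Proof.
move=> d0; have [B cB HB] := unit_ball_precompact S.
have Sd : 0 < S d by rewrite -(rmorph0 S) emb_lt.
move: cB; rewrite compact_cover.
move=> /(_ K setT (fun k => interior (ball k (S d))))[|k Bk|D _ HD].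
- by move=> k _; exact: open_interior.
- by exists k => //; exact: nbhsx_ballx.
exists (finmap.enum_fset D) => k k1.
have [|u /= uD /interior_subset/ball_nr ku] := HD k.
  by apply: HB; rewrite -(emb_nr S) -(rmorph1 S) emb_le.
by exists u => //; rewrite nrC ltW.
Qed.

End Coordinates.

(** * Finite nets, and separability of the space of seminorms *)

Section Nets.
Variables (R : realType) (K : numFieldType) (S : scalar_field R K).
Local Notation cn := (coord_norm S).

Section Vect.
Variable V : vectType K.
Local Notation b := (vbasis {:V}).

Lemma nr_coord i (v : V) : nr S (coord b i v) <= cn v.
Proof.
by rewrite /coord_norm (bigD1 i)//= lerDl; apply: sumr_ge0 => j _; exact: nr_ge0.
Qed.

(** Vectors whose coordinates are taken from a net of scalars. *)
Lemma vect_net d : 0 < d -> exists s : seq V,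
  forall v, cn v <= 1 -> exists2 u, u \in s & cn (v - u) <= d.
Proof.
move=> d0; set n := \dim {:V}.
have [|s Hs] := @scalar_net _ _ S (d / n.+1%:R); first by rewrite divr_gt0.
pose F (f : {ffun 'I_n -> 'I_(size s)}) := \sum_(i < n) s`_(f i) *: b`_i.
exists [seq F f | f <- enum {ffun 'I_n -> 'I_(size s)}] => v v1.
have /choice[u Hu] i : exists u : 'I_(size s), nr S (coord b i v - s`_u) <= d / n.+1%:R.
  have [k ks Hk] := Hs _ (le_trans (nr_coord i v) v1).
  have ik : (index k s < size s)%N by rewrite index_mem.
  by exists (Ordinal ik); rewrite /= nth_index.
exists (F (finfun u)); first by apply: map_f; rewrite mem_enum.
apply: (@le_trans _ _ (\sum_(i < n) d / n.+1%:R)).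
  apply: ler_sum => i _; rewrite linearB /= /F coord_sum_free.
    by rewrite ffunE.
  by apply: basis_free; exact: vbasisP.
rewrite sumr_const card_ord -[X in X <= _]mulr_natr mulrAC ler_pdivrMr ?ltr0n//.
by rewrite ler_pM2l// ler_nat.
Qed.

(** Multiples of net points by integers; the net at precision k is scaled by m
    to reach vectors of norm at most m. *)
Lemma vect_dense : exists t : nat -> V, forall v e, 0 < e -> exists l, cn (v - t l) <= e.
Proof.
have /choice[net Hnet] : forall k, exists s : seq V,
    forall v, cn v <= 1 -> exists2 u, u \in s & cn (v - u) <= recip R k.
  by move=> k; apply: vect_net; exact: recip_gt0.
pose t (l : nat) : V :=
  if (unpickle l : option (nat * nat * nat)) is Some (m, k, i)
  then S m%:R *: (net k)`_i else 0.
exists t => v e e0; have ps := coord_normP S V.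
pose m := (Num.truncn (cn v)).+1.
have m0 : (0 : R) < m%:R by rewrite ltr0n.
have vm : cn v <= m%:R.
  by have /truncn_itv/andP[_ /ltW] := sn_ge0 ps v.
have [|k /(_ k (leqnn _)) Hk] := @recip_small R (e / m%:R); first by rewrite divr_gt0.
have nrm : nr S (S m%:R) = m%:R by rewrite nr_emb// ltW.
have nrmV : nr S (S m%:R^-1) = m%:R^-1 by rewrite nr_emb// invr_ge0 ltW.
have [|u us Hu] := Hnet k (S m%:R^-1 *: v).
  by rewrite (snZ ps) nrmV ler_pdivrMl// mulr1.
exists (pickle (m, k, index u (net k))); rewrite /t pickleK nth_index//.
have -> : v - S m%:R *: u = S m%:R *: (S m%:R^-1 *: v - u).
  by rewrite scalerBr scalerA -rmorphM mulfV ?gt_eqF// rmorph1 scale1r.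
rewrite (snZ ps) nrm -ler_pdivlMl// mulrC; exact: le_trans Hu Hk.
Qed.

(** Separability of the space of seminorms: seminorms with the same code at
    precision k differ by at most 1 / (k + 1) on the unit ball.  The code
    records a Lipschitz constant M of p and the rounded values of p on a net
    whose mesh is small compared with 1 / M. *)
Lemma seminorm_code : exists c : nat -> (V -> R) -> nat,
  forall k p q, is_seminorm S p -> is_seminorm S q -> c k p = c k q ->
  forall v, p v <= q v + recip R k * cn v.
Proof.
have cs := coord_normP S V.
have /choice[M HM] (p : V -> R) : exists M : nat,
    is_seminorm S p -> forall v, p v <= M%:R * cn v.
  have [ps|nps] := pselect (is_seminorm S p); last by exists 0%N.
  have [C C0 HC] := seminorm_le_coord_norm ps.
  exists (Num.truncn C).+1 => _ v; apply: le_trans (HC v) _.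
  apply: ler_wpM2r; first exact: sn_ge0 cs _.
  by have /truncn_itv/andP[_ /ltW] := C0.
(* The total error is recip R k / 4 from rounding, plus twice M times this mesh. *)
pose d k m : R := recip R k / 4 / m.+1%:R.
have d0 k m : 0 < d k m by rewrite !divr_gt0// recip_gt0.
have /choice[net Hnet] : forall km, exists s : seq V,
    forall v, cn v <= 1 -> exists2 u, u \in s & cn (v - u) <= d km.1 km.2.
  by move=> km; exact: vect_net.
pose digit k (p : V -> R) u := Num.truncn (p u / (recip R k / 4)).
exists (fun k p => pickle (M p, [seq digit k p u | u <- net (k, M p)])).
move=> k p q ps qs /(pcan_inj pickleK)[eM]; rewrite -eM => /eq_in_map pq.
have r0 := recip_gt0 R k.
have unit_case v : cn v <= 1 -> p v <= q v + recip R k.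
  move=> v1; have [u /pq du Hu] := Hnet (k, M p) v v1.
  have r4 : 0 < recip R k / 4 by rewrite divr_gt0.
  have pu : p u <= q u + recip R k / 4.
    have /truncn_itv/andP[_] : 0 <= p u / (recip R k / 4).
      by rewrite divr_ge0// ?(sn_ge0 ps)// ltW.
    have /truncn_itv/andP[+ _] : 0 <= q u / (recip R k / 4).
      by rewrite divr_ge0// ?(sn_ge0 qs)// ltW.
    rewrite -/(digit k q u) -/(digit k p u) du ler_pdivlMr// ltr_pdivrMr//.
    rewrite -natr1; lra.
  have Md : (M p)%:R * cn (v - u) <= recip R k / 4.
    apply: le_trans (ler_wpM2l (ler0n _ _) Hu) _.
    rewrite /d /= mulrCA mulrC ler_piMl ?(ltW r4)//.
    by rewrite ler_pdivrMr ?ltr0n// mul1r ler_nat.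
  have := sn_le_dist ps v u; have := sn_le_dist qs u v.
  have := HM p ps (v - u); have := HM q qs (u - v).
  rewrite -eM -(snN cs (u - v)) opprB; lra.
move=> v; have [c0|c0] := eqVneq (cn v) 0.
  have := HM p ps v; rewrite c0 !mulr0 addr0 => pv.
  exact: le_trans pv (sn_ge0 qs _).
have cp : 0 < cn v by rewrite lt_neqAle eq_sym c0 (sn_ge0 cs).
have nrc : nr S (S (cn v)^-1) = (cn v)^-1 by rewrite nr_emb// invr_ge0 ltW.
have := unit_case (S (cn v)^-1 *: v).
rewrite (snZ cs) (snZ ps) (snZ qs) nrc mulVf// lexx => /(_ isT).
by rewrite ler_pdivrMl// mulrDr mulrA mulfV// mul1r [cn v * _]mulrC.
Qed.

End Vect.

Lemma chain_limit_separable (E : chain K) (G : normedModType K) :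
  chain_limit S E G -> separable G.
Proof.
move=> [j [jc jd]].
have t n : {t : nat -> E n | forall v e, 0 < e -> exists l, cn (v - t l) <= e}.
  exact/cid/vect_dense.
pose y (l : nat) : G :=
  if (unpickle l : option (nat * nat)) is Some (n, k) then j n (sval (t n) k) else 0.
exists (range y).
  exact: sub_countable (card_image_le y setT) (countableP _).
apply/(nr_denseP S) => z e e0.
have [|_ [n [x <-]] zx] := jd z (e / 2); first by rewrite divr_gt0.
have [C C0 HC] := seminorm_le_coord_norm (nr_seminorm S (E n)).
have C1 : 0 < C + 1 by rewrite ltr_wpDl.
have [|l Hl] := svalP (t n) x (e / 2 / (C + 1)); first by rewrite !divr_gt0.
exists (j n (sval (t n) l)); first by exists (pickle (n, l)); rewrite // /y pickleK.
apply: le_trans (nr_trans S (j n x) _ _) _; rewrite -linearB iso_nr.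
have := HC (x - sval (t n) l); have := sn_ge0 (coord_normP S (E n)) (x - sval (t n) l).
move: Hl; rewrite ler_pdivlMr//; lra.
Qed.

End Nets.

(** * Existence of a Gurarii space *)

Section Saturation.
Variables (R : realType) (K : numFieldType) (S : scalar_field R K).
Local Notation cn := (coord_norm S).

(** Composed with i, this is a projection of B onto the range of i. *)
Lemma left_inverse_ex (A B : vectType K) (i : {linear A -> B}) :
  injective i -> exists P : {linear B -> A}, cancel i P.
Proof.
move=> inj; exists (linfun i)^-1%VF => a.
have ker0 : lker (linfun i) == 0%VS.
  by apply/lker0P => x y; rewrite !lfunE => /inj.
by have /= := lker0_lfunK ker0 a; rewrite lfunE.
Qed.

(** An extension B of E is, up to isometry, a seminorm on the sum of E and of a
    coordinate space that restricts to the norm of E.  For each dimension,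
    precision and code, t lists one such seminorm with this code, if any.
    The map h goes from B to the sum, and then to the quotient by the listed
    seminorm; the additive error becomes relative to the norm of B because the
    first of these maps is bounded. *)
Lemma extension_net (E : finDimNormedModType K) : exists t : nat -> extension E,
  forall (x : extension E) e, 0 < e ->
  exists (l : nat) (h : {linear ext_space x -> ext_space (t l)}),
    (forall a, h (ext_incl x a) = ext_incl (t l) a) /\ near_isometry S e h.
Proof.
pose V d := (E * 'rV[K]_d)%type : vectType K.
pose good d (p : V d -> R) := is_seminorm S p /\ forall a, p (a, 0) = nr S a.
pose code d := sval (cid (seminorm_code S (V d))).
have Hcode d k p q : is_seminorm S p -> is_seminorm S q -> code d k p = code d k q ->
    forall v, p v <= q v + recip R k * cn v.
  exact: (svalP (cid (seminorm_code S (V d)))).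
pose realizes d (p : V d -> R) (x : extension E) := exists q : {linear V d -> ext_space x},
  (forall v, nr S (q v) = p v) /\ forall a, q (a, 0) = ext_incl x a.
have realize d (p : V d -> R) : good d p -> exists x, realizes d p x.
  move=> [ps pE]; have [W [q [s [_ qp]]]] := seminorm_separation ps.
  have ilin : linear (fun a : E => q (a, 0)).
    by move=> k a a'; rewrite -linearP; congr (q (_, _)); rewrite /= scaler0 addr0.
  have inr a : nr S (q (a, 0)) = nr S a by rewrite qp pE.
  by exists (Extension (mk_iso ilin inr)), q.
pose t (l : nat) : extension E :=
  if (unpickle l : option (nat * nat * nat)) is Some (d, k, c)
  then pick_or (trivial_extension E) (fun x => exists p, [/\ good d p, code d k p = c & realizes d p x])
  else trivial_extension E.
exists t => x e e0; case: x => B i /=.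
pose d := \dim {:B}; pose b := vbasis {:B}.
have flin : linear (fun v : V d => i v.1 + \sum_j v.2 0 j *: b`_j).
  move=> k [a v] [a' v'] /=; rewrite linearP scalerDr addrACA scaler_sumr -big_split /=.
  by congr (_ + _); apply: eq_bigr => j _; rewrite !mxE scalerDl scalerA.
pose f := mk_linear flin.
have [P iP] := left_inverse_ex (@iso_inj _ _ S _ _ i).
(* A section of f which maps i a to (a, 0): y splits as i (P y) and a rest. *)
pose s0 (y : B) : V d := (P y, \row_j coord b j (y - i (P y))).
have slin : linear s0.
  move=> k y y'.
  have e1 : k *: y + y' - i (P (k *: y + y')) = k *: (y - i (P y)) + (y' - i (P y')).
    by rewrite scalerBr addrACA -opprD -!linearP.
  rewrite /s0 e1; congr (_, _); first exact: linearP.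
  by apply/rowP => j; rewrite !mxE linearP.
pose s : {linear B -> V d} := mk_linear slin.
have fs y : f (s y) = y.
  rewrite /= (eq_bigr (fun j => coord b j (y - i (P y)) *: b`_j)); last by move=> j _; rewrite mxE.
  by rewrite -coord_sum addrC subrK.
have si a : s (i a) = (a, 0).
  by rewrite /= /s0 iP subrr; congr (_, _); apply/rowP => j; rewrite !mxE linear0.
pose p (v : V d) := nr S (f v).
have pgood : good d p.
  split; first by split=> [v w _ _|k v _]; rewrite /p ?linearD ?linearZ ?nrZ// nrD.
  by move=> a; rewrite /p -si fs iso_nr.
have cs : is_seminorm S (fun y => cn (s y)).
  have cnP := coord_normP S (V d).
  by split=> [v w _ _|k v _]; rewrite ?linearD ?linearZ; [exact: snD cnP _ _|exact: snZ cnP _ _].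
have [C C0 HC] := seminorm_bounded cs.
have C1 : 0 < C + 1 by rewrite ltr_wpDl.
have [|k /(_ k (leqnn _)) Hk] := @recip_small R (e / (C + 1)); first by rewrite divr_gt0.
exists (pickle (d, k, code d k p)); rewrite /t pickleK.
set Q := (X in pick_or _ X); have : Q (pick_or (trivial_extension E) Q).
  by apply: pick_orP; have [y Hy] := realize _ _ pgood; exists y, p.
move=> [p' [p'good cp [q [qp qE]]]].
have hE y : lcomp q s y = q (s y) by [].
exists (lcomp q s); split=> [a|y]; first by rewrite hE si qE.
rewrite hE qp.
have small : recip R k * cn (s y) <= e * nr S y.
  apply: le_trans (ler_wpM2l (ltW (recip_gt0 R k)) (HC y)) _.
  rewrite mulrA; apply: ler_wpM2r; first exact: nr_ge0.
  by move: Hk; rewrite ler_pdivlMr//; have := recip_gt0 R k; nra.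
have H1 := Hcode d k p p' pgood.1 p'good.1 (esym cp) (s y).
have H2 := Hcode d k p' p p'good.1 pgood.1 cp (s y).
have pE : p (s y) = nr S y by rewrite /p fs.
by move: H1 H2; rewrite pE; lra.
Qed.

(** The exact pushout: an extension of E becomes one of F. *)
Lemma push_extension (E F : finDimNormedModType K) (i : isometric_embedding E F)
    (x : extension E) : exists (y : extension F) (w : isometric_embedding (ext_space x) (ext_space y)),
  forall a, w (ext_incl x a) = ext_incl y (i a).
Proof.
have i0 : near_isometry S 0 i by move=> a; rewrite subr0 addr0 mul1r iso_nr lexx.
have [W [b [c H]]] := amalgamation (ext_incl x) (lexx 0) i0.
exists (Extension c), b => a /=; apply/eqP; rewrite -subr_eq0; apply/eqP.
apply: (@nr_eq0 _ _ S); apply/le_anti; rewrite nr_ge0 andbT.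
by have := H a; rewrite mul0r.
Qed.

(** The task k of the m-th space is treated at time 2^m (2 k + 1) - 1, when
    that space has already been played. *)
Lemma schedule_ex : exists mk : nat -> nat * nat,
  forall m k, exists2 n, (m <= n)%N & mk n = (m, k).
Proof.
exists (fun n => (logn 2 n.+1, (n.+1 %/ 2 ^ logn 2 n.+1)./2)) => m k.
pose n := (2 ^ m * k.*2.+1)%N.
have n0 : (0 < n)%N by rewrite muln_gt0 expn_gt0.
have ln : logn 2 n = m.
  rewrite lognM ?expn_gt0// pfactorK// logn_coprime ?addn0//.
  by rewrite prime_coprime// dvdn2 /= odd_double.
exists n.-1; last by rewrite prednK// ln mulKn ?expn_gt0//= uphalf_double.
by rewrite -ltnS prednK// (leq_trans (ltn_expl m (ltnSn 1)))// leq_pmulr.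
Qed.

(** [tasks n E c m k] is the k-th task of the m-th space, pushed to the last
    space E of the chain c.  The rule plays the scheduled task itself. *)
Lemma saturated_chain_ex : exists E : chain K,
  forall m (x : extension (E m)) e, 0 < e ->
  exists n (h : {linear ext_space x -> E n}),
    [/\ (m <= n)%N, forall a, h (ext_incl x a) = transfer a n & near_isometry S e h].
Proof.
pose t (E : finDimNormedModType K) := sval (cid (extension_net E)).
pose push (E F : finDimNormedModType K) (i : isometric_embedding E F) (x : extension E) :=
  sval (cid (push_extension i x)).
pose tasks := fix tasks n (E : finDimNormedModType K) (c : finite_chain n E) (m k : nat) : extension E :=
  match c in finite_chain n E return extension E with
  | ChainStart E => t E k
  | ChainStep n E F c i => if m == n.+1 then t F k else push E F i (tasks n E c m k)
  end.
have [mk Hmk] := schedule_ex; have [Z _] := zero_space_ex S.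
pose r : rule K := fun n E c => tasks n E c (mk n).1 (mk n).2.
have [E rE] := rule_chain_ex r Z; exists E => m x e e0.
have tasksP k n : (m <= n)%N -> exists w : isometric_embedding
    (ext_space (t (E m) k)) (ext_space (tasks n _ (chain_prefix E n) m k)),
    forall a, w (ext_incl (t (E m) k) a) = ext_incl (tasks n _ (chain_prefix E n) m k) (transfer a n).
  move: n; apply: transfer_ind => [|n mn [w Hw]].
    have -> : tasks m _ (chain_prefix E m) m k = t (E m) k.
      by case: (m) => //= n; rewrite eqxx.
    by exists (iso_id S _) => a; rewrite transfer_id.
  rewrite /= ltn_eqF ?ltnS//.
  rewrite /push; case: cid => y /= [v Hv].
  by exists (iso_comp S v w) => a; rewrite transferS//= Hw Hv.
have [k [h [hx hd]]] := svalP (cid (extension_net (E m))) x e e0.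
have [n mn nE] := Hmk m k.
have [w Hw] := tasksP k n mn.
have := rE n; rewrite /r nE /= => eE.
rewrite -eE /= in w Hw.
exists n.+1, (lcomp w h); split=> [|a|y] /=.
- exact: leqW.
- by rewrite hx Hw -transferS.
- by rewrite iso_nr; exact: hd.
Qed.

(** The images of finitely many basis vectors are approximated in one space of
    the chain; the error is uniform because coordinates are bounded. *)
Lemma limit_approx (E : chain K) (G : normedModType K)
    (j : forall n, isometric_embedding (E n) G)
    (jc : forall n x, j n.+1 (chain_incl E n x) = j n x)
    (jd : nr_dense S (chain_range j))
    (A : finDimNormedModType K) (e : {linear A -> G}) d : 0 < d ->
  exists n (e' : {linear A -> E n}), forall a, nr S (e a - j n (e' a)) <= d * nr S a.
Proof.
move=> d0; have [C C0 HC] := coord_norm_bounded S A.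
have C1 : 0 < C + 1 by rewrite ltr_wpDl.
have dC : 0 < d / (C + 1) by rewrite divr_gt0.
pose b := vbasis {:A}.
have /choice[u Hu] (l : 'I_(\dim {:A})) : exists u : {n & E n},
    nr S (e b`_l - j _ (projT2 u)) <= d / (C + 1).
  have [_ [n [x <-]] xl] := jd (e b`_l) _ dC.
  by exists (existT (fun n => E n : Type) n x); exact: xl.
pose N := \max_l projT1 (u l).
have uN l : (projT1 (u l) <= N)%N by exact: leq_bigmax.
have elin : linear (fun a => \sum_l coord b l a *: transfer (projT2 (u l)) N).
  move=> k a a'; rewrite scaler_sumr -big_split; apply: eq_bigr => l _ /=.
  by rewrite linearP scalerDl scalerA.
exists N, (mk_linear elin) => a /=.
rewrite {1}(coord_sum a) (linear_sum e) (linear_sum (j N)) -sumrB.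
apply: le_trans (nr_sum _ _ _ _) _.
apply: (@le_trans _ _ (d / (C + 1) * cn a)).
  rewrite /coord_norm mulr_sumr; apply: ler_sum => l _.
  rewrite (linearZ_LR e) (linearZ_LR (j N)) /= -scalerBr nrZ mulrC; apply: ler_wpM2r; first exact: nr_ge0.
  by rewrite (coherent_transfer jc _ (uN l)).
apply: le_trans (ler_wpM2l (ltW dC) (HC a)) _.
rewrite mulrA; apply: ler_wpM2r; first exact: nr_ge0.
rewrite mulrAC ler_pdivrMr//; apply: ler_wpM2l; first exact: ltW.
by rewrite lerDl ler01.
Qed.

(** The amalgamation is along the approximation e' of e, which is only almost
    isometric; the resulting f0 is within 3 d of e on A, and f0 is corrected
    by (e - f0 i) P, where P is a left inverse of i of norm at most C. *)
Lemma saturated_limit_gurarii (E : chain K) (G : normedModType K) :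
  (forall m (x : extension (E m)) e, 0 < e ->
   exists n (h : {linear ext_space x -> E n}),
     [/\ (m <= n)%N, forall a, h (ext_incl x a) = transfer a n & near_isometry S e h]) ->
  chain_limit S E G -> gurarii_property G.
Proof.
move=> sat [j [jc jd]] eps eps0 A B i e.
have [ep ep0 ->] := emb_pos S eps0.
have [P iP] := left_inverse_ex (@iso_inj _ _ S _ _ i).
have ps : is_seminorm S (fun y => nr S (P y)).
  by split=> [v w _ _|k v _]; rewrite ?linearD ?linearZ ?nrZ// nrD.
have [C C0 HC] := seminorm_bounded ps.
have c1 : 0 < 1 + 3 * C + ep by lra.
(* f0 is isometric up to d, and the correction adds at most 3 d C. *)
pose d := ep / (1 + 3 * C + ep).
have d0 : 0 < d by rewrite divr_gt0.
have d1 : d <= 1 by rewrite ler_pdivrMr//; lra.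
have dep : d * (1 + 3 * C) <= ep.
  have : d * (1 + 3 * C + ep) = ep by rewrite /d divfK// gt_eqF.
  by have := mulr_gt0 d0 ep0; lra.
have [n [e' He']] := limit_approx jc jd e d0.
have e'd : near_isometry S d e'.
  move=> a; have := He' a; rewrite -(iso_nr S (j n)) => H.
  have := nr_le_dist S (e a) (j n (e' a)); have := nr_le_dist S (j n (e' a)) (e a).
  rewrite (nrC S (j n _)) (iso_nr S e); lra.
have [W [b [c Hbc]]] := amalgamation i (ltW d0) e'd.
have [n' [h [nn' hc hd]]] := sat n (Extension c) d d0.
pose f0 := lcomp (j n') (lcomp h b).
have f0d y : (1 - d) * nr S y <= nr S (f0 y) <= (1 + d) * nr S y.
  by rewrite /= iso_nr -(iso_nr S b); exact: hd.
have f0i a : nr S (e a - f0 (i a)) <= 3 * d * nr S a.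
  apply: le_trans (nr_trans S (j n (e' a)) _ _) _.
  have -> : j n (e' a) - f0 (i a) = j n' (h (c (e' a) - b (i a))).
    by rewrite !linearB /= -(coherent_transfer jc (e' a) nn') -hc.
  have /andP[_ H] := hd (c (e' a) - b (i a)); move: H; rewrite (nrC S (c _)) iso_nr.
  have := Hbc a; have := He' a; have := nr_ge0 S (b (i a) - c (e' a)).
  have := nr_ge0 S a; nra.
have flin : linear (fun y => f0 y + (e (P y) - f0 (i (P y)))).
  move=> k y y'.
  rewrite (linearP P) (linearP i) !(linearP f0) (linearP e).
  rewrite opprD (addrACA (k *: e _)) -scalerBr (addrACA (k *: f0 y)) -scalerDr.
  by [].
exists (mk_linear flin) => [a|] /=; first by rewrite iP addrC subrK.
apply/near_isometryP => y /=.
have H1 := f0d y; have H2 := f0i (P y); have H3 := HC y.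
set u := f0 y in H1 *; set v := e (P y) - _ in H2 *.
have := nrD S u v; have := nr_le_dist S u (- v); rewrite opprK nrN => H4 H5.
have H6 : 3 * d * nr S (P y) <= 3 * d * (C * nr S y) by rewrite ler_wpM2l// mulr_ge0// ltW.
have H7 := ler_wpM2r (nr_ge0 S y) dep.
by move/andP: H1 => [H1 H1']; apply/andP; split; lra.
Qed.

Lemma gurarii_space_ex : exists G : completeNormedModType K,
  separable G /\ gurarii_property G.
Proof.
have [E sat] := saturated_chain_ex; have [G EG] := chain_limit_ex S E.
exists G; split; first exact: chain_limit_separable EG.
exact: saturated_limit_gurarii EG.
Qed.

End Saturation.

Theorem theorem1 (R : realType) (K : numFieldType)
    (scalars : real_or_complex R K) :
  exists G : completeNormedModType K,
    [/\ separable G,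
        exists Sigma : odd_strategy K, leads_to Sigma G,
        forall G' : completeNormedModType K, separable G' ->
          (exists Sigma' : odd_strategy K, leads_to Sigma' G') ->
          linearly_isometric G' G
      & is_the_gurarii_space G].
Proof.
have [S _] := real_or_complex_scalar_field scalars.
have [G [sepG GG]] := gurarii_space_ex S.
have [s sG] := gurarii_strategy_leads_to S sepG GG.
exists G; split=> //; first by exists s.
- by move=> H sepH [t tH]; exact: (leads_to_unique S) tH sG.
- split=> // H sepH GH; have [t tH] := gurarii_strategy_leads_to S sepH GH.
  exact: (leads_to_unique S) tH sG.
Qed.
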